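(* Keep the per-unit information fixed and let $n\to\infty$. Let $G^\star$ be a fixed probability measure on $\mathcal V$ with $\nu_i\overset{iid}{\sim}G^\star$, and let the primary parameters $\theta^\star=\theta^\star_n$ be fixed for each $n$ (empirical Bayes frame). Suppose Assumptions 1, 2, 3 and 4 hold and that $$\mathbb E_{G^\star}\big[\mathfrak D_{\mathrm{BL}}\big(G_\Pi[U_1,\dots,U_n],G^\star\big)\big]\to0\quad\text{as }n\to\infty.$$ Then $$\limsup_{n\to\infty}\sup_{\alpha\in[0,1]}\max_{i\in\mathcal H_0}\big|\mathbb P_{G^\star,\theta^\star}(P_i\le\alpha)-\alpha\big|=0.$$
   Context: Setup: for units $i=1,\dots,n$, the data of unit $i$ are summarized by a test statistic $T_i\in\mathbb R$ and a nuisance parameter statistic $U_i\in\mathcal U$. Unit $i$ has a primary parameter $\theta_i$ and a nuisance parameter $\nu_i\in\mathcal V$. Conditionally on parameters, the pairs $(T_i,U_i)$ are independent across $i$, the law of $(T_i,U_i)$ depends only on $(\theta_i,\nu_i)$ (the same conditional law for every $i$ and $n$), and the law of $U_i$ depends only on $\nu_i$. The hierarchical model used for inference posits $\nu_i\mid G$ i.i.d. $G$, $G\sim\Pi$, for a fixed prior $\Pi$ on probability measures on $\mathcal V$. A null value $\theta_0$ is fixed, $\mathcal H_0=\{i:\theta_i^\star=\theta_0\}$. Partially Bayes p-value: $P_i:=\mathfrak P_i(T_i,(U_1,\dots,U_n);\Pi)$ with $\mathfrak P_i(t,(u_1,\dots,u_n);\Pi):=\mathbb P_\Pi(|T_i|\ge|t|\mid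 U_1=u_1,\dots,U_n=u_n)$ under the joint hierarchical law with $\theta_i=\theta_0$. Oracle p-value function: $P^{\mathrm{or}}(t,u,\nu):=\mathbb P(|T_i|\ge|t|\mid U_i=u,\nu_i=\nu)$ under $\theta_i=\theta_0$. Posterior mean: $G_\Pi[u_1,\dots,u_m](A):=\mathbb E_\Pi[G(A)\mid U_1=u_1,\dots,U_m=u_m]$. Bounded Lipschitz metric on probability measures on $\mathcal V$: $\mathfrak D_{\mathrm{BL}}(G,G'):=\sup\{|\int\psi\,dG-\int\psi\,dG'|:\|\psi\|_\infty\le1,\ \psi\text{ 1-Lipschitz}\}$. $\mathbb P_{G^\star,\theta^\star}$, $\mathbb E_{G^\star}$: probability/expectation with $\theta^\star$ fixed, $\nu_i$ i.i.d. $G^\star$, data drawn given parameters. Assumption 1: for all $\nu,u$, the conditional law of $T_i$ given $\nu_i=\nu,U_i=u$ (under $\theta_i=\theta_0$) is absolutely continuous w.r.t. Lebesgue measure. Assumption 2: $\mathcal V$ is a compact metric space with metric $d$. Assumption 3: the family of functions $\nu\mapsto P^{\mathrm{or}}(t,u,\nu)$, indexed by $t\in\mathbb R$, $u\in\mathcal U$, is uniformly equicontinuous on $\mathcal V$. Assumption 4: the family $\{\mathbb P(U_i\in\cdot\mid\nu_i=\nu):\nu\in\mathcal V\}$ is tight ($\mathcal U$ a topological space: for each $\varepsilon>0$ there is a compact $C\subset\mathcal U$ with $\mathbb P(U_i\notin C\mid\nu_i=\nu)<\varepsilon$ for all $\nu$); all these laws are absolutely continuous w.r.t. a measure $\lambda$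 on $\mathcal U$ with densities $p(u\mid\nu)$; and for every compact $C\subset\mathcal U$, $\lambda(C)<\infty$ and the functions $\{\nu\mapsto p(u\mid\nu):u\in C\}$ are uniformly bounded and equicontinuous. *)

(* Defs.v *)
From mathcomp Require Import all_boot all_order all_algebra.
From mathcomp Require Import all_classical all_reals all_analysis.
From mathcomp Require Import measurable_realfun.
Set Implicit Arguments.
Unset Strict Implicit.
Unset Printing Implicit Defensive.
Import Order.TTheory GRing.Theory Num.Theory.
Import numFieldNormedType.Exports.
Local Open Scope classical_set_scope.
Local Open Scope ring_scope.

Definition is_metric {R : realType} {V : Type} (d : V -> V -> R) : Prop :=
  [/\ forall x y, 0 <= d x y,
      forall x y, d x y = 0 <-> x = y,
      forall x y, d x y = d y x &
      forall x y z, d x z <= d x y + d y z].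

Definition dopen {R : realType} {V : Type} (d : V -> V -> R) (A : set V) : Prop :=
  forall x, A x -> exists2 e : R, 0 < e & forall y, d x y < e -> A y.

Definition dcompact_space {R : realType} {V : Type} (d : V -> V -> R) : Prop :=
  forall C : set (set V), C `<=` dopen d -> setT `<=` \bigcup_(A in C) A ->
  exists (k : nat) (F : 'I_k -> set V),
    (forall i, C (F i)) /\ setT `<=` \bigcup_(i in setT) F i.

Definition Vm {R : realType} {V : pointedType} (d : V -> V -> R) :=
  g_sigma_algebraType (dopen d).

Definition Um (U : ptopologicalType) := g_sigma_algebraType (@open U).

Definition BL1 {R : realType} {V : Type} (d : V -> V -> R) : set (V -> R) :=
  [set psi | (forall x, `|psi x| <= 1) /\ (forall x y, `|psi x - psi y| <= d x y)].

Definition dBL {R : realType} {V : pointedType} (d : V -> V -> R)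
  (m1 m2 : set (Vm d) -> \bar R) : \bar R :=
  ereal_sup [set `|((\int[m1]_x (psi x)%:E) - (\int[m2]_x (psi x)%:E))%E|%E
             | psi in BL1 d].

Section model.
Context {R : realType} {V : pointedType} (d : V -> V -> R)
        {U : ptopologicalType}.
Local Notation VV := (Vm d).
Local Notation UU := (Um U).

Definition lawU (lam : {measure set UU -> \bar R}) (p : UU -> VV -> R)
  (nu : VV) (B : set UU) : \bar R :=
  \int[lam]_(u in B) (p u nu)%:E.

(* oracle p-value  P^or(t,u,nu) = P(|T_i| >= |t| | U_i = u, nu_i = nu),
   where Kc nu u is the conditional law of T_i given nu_i = nu, U_i = u
   (under theta_i = theta_0) *)
Definition Por (Kc : VV -> UU -> probability R R) (t : R) (u : UU) (nu : VV) : R :=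
  fine (Kc nu u [set x : R | `|t| <= `|x|]).

Definition margU (p : UU -> VV -> R) (G : probability VV R) (u : UU) : \bar R :=
  (\int[G]_nu (p u nu)%:E)%E.

Definition evid (Pi : probability (pprobability VV R) R) (p : UU -> VV -> R)
  (s : seq UU) : \bar R :=
  (\int[Pi]_G \prod_(u <- s) margU p G u)%E.

(* posterior mean  G_Pi[u_1..u_m](A) = E_Pi[G(A) | U_1 = u_1,..,U_m = u_m]
   (Bayes formula) *)
Definition postmean (Pi : probability (pprobability VV R) R) (p : UU -> VV -> R)
  (s : seq UU) : set VV -> \bar R :=
  fun A => (fine (\int[Pi]_G
                    ((\prod_(u <- s) margU p G u) * (G : probability VV R) A))%E
            / fine (evid Pi p s))%:E.

(* partially Bayes p-value
   frakP_i(t,(u_1..u_n);Pi) = P_Pi(|T_i| >= |t| | U_1 = u_1,..,U_n = u_n)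
   under the hierarchical law with theta_i = theta_0 (Bayes formula);
   units are indexed 0..n-1 *)
Definition pvalPB (Pi : probability (pprobability VV R) R) (p : UU -> VV -> R)
  (Kc : VV -> UU -> probability R R) (i : nat) (t : R) (s : seq UU) : R :=
  fine (\int[Pi]_G
          ((\prod_(j < size s | j != i :> nat) margU p G (nth point s j))
           * \int[(G : probability VV R)]_nu (Por Kc t (nth point s i) nu * p (nth point s i) nu)%:E))%E
  / fine (evid Pi p s).

(* expectation under P_{Gstar,theta}: nu_j iid Gstar, (T_j,U_j) | nu_j ~ kappa (theta j) nu_j,
   independently over the units j, j0 <= j < j0 + k; F is evaluated at the list
   [:: (T_j0,U_j0); ...] *)
Fixpoint dataint {Th : Type} (Gs : probability VV R)
  (kappa : Th -> VV -> probability (R * UU)%type R) (th : nat -> Th)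
  (j0 k : nat) (F : seq (R * UU) -> \bar R) : \bar R :=
  match k with
  | 0 => F [::]
  | k'.+1 => (\int[Gs]_nu \int[kappa (th j0) nu]_x
               dataint Gs kappa th j0.+1 k' (fun s => F (x :: s)))%E
  end.

Definition expected_dBL {Th : Type} (Gs : probability VV R)
  (kappa : Th -> VV -> probability (R * UU)%type R) (thn : nat -> nat -> Th)
  (Pi : probability (pprobability VV R) R) (p : UU -> VV -> R) (n : nat) : \bar R :=
  dataint Gs kappa (thn n) 0 n
    (fun s => dBL (postmean Pi p (map snd s)) Gs).

Definition prob_pval_le {Th : Type} (Gs : probability VV R)
  (kappa : Th -> VV -> probability (R * UU)%type R) (thn : nat -> nat -> Th)
  (Pi : probability (pprobability VV R) R) (p : UU -> VV -> R)
  (Kc : VV -> UU -> probability R R) (n i : nat) (alpha : R) : \bar R :=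
  dataint Gs kappa (thn n) 0 n
    (fun s => (if (pvalPB Pi p Kc i (nth (0, point) s i).1 (map snd s) <= alpha)%R
               then 1 else 0)%:E).

(* sup_{alpha in [0,1]} max_{i in H_0} |P(P_i <= alpha) - alpha|
   (the max over an empty H_0 is taken to be 0) *)
Definition calib_err {Th : Type} (th0 : Th) (Gs : probability VV R)
  (kappa : Th -> VV -> probability (R * UU)%type R) (thn : nat -> nat -> Th)
  (Pi : probability (pprobability VV R) R) (p : UU -> VV -> R)
  (Kc : VV -> UU -> probability R R) (n : nat) : \bar R :=
  ereal_sup ([set 0%E] `|`
    [set x | exists (i : nat) (alpha : R),
        [/\ (i < n)%N, thn n i = th0, 0 <= alpha <= 1 &
            x = `|(prob_pval_le Gs kappa thn Pi p Kc n i alpha - alpha%:E)%E|%E]]).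

End model.

(* Main.v *)
(* Fix a null unit [i] and condition on the other nuisance statistics
   [us = (U_j)_{j <> i}].  By Bayes' formula the partially Bayes p-value of unit
   [i] is the ratio [int Por p dm / int p dm], where [m] is the posterior mean
   given [us] only; since [us] has the law of [n - 1] observations, the
   consistency hypothesis for sample size [n - 1] makes [m] close to [Gs].
   On a compact set of values of [U_i] the functions [Por t u * p u] are
   uniformly bounded and equicontinuous, hence uniformly approximated by
   functions that are Lipschitz with a common constant, so [m] and [Gs] integrate
   them to nearly the same value, uniformly in [t] and [u].  The p-value is
   monotone in [|t|], so its rejection region is, for each [u], a tail
   [{|t| >= c}]; as the tails have continuous mass, the conditional probability
   of that region is [alpha] up to the same error.  Integrating over [u]
   (dominated convergence; tightness outside the compact set) bounds the error
   given [us], and Markov's inequality for the bounded Lipschitz distance bounds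
   the average over [us], uniformly in [alpha] and [i]. *)

(* Leaving out unit [i] has two purposes: the posterior mean then does not involve [U_i], and the
   law of the remaining [U_j] is free of the primary parameters, so consistency under [thn n]
   applies to a sample of size [n.+1] with one unit removed. There is no lower bound on the density
   of [U_i], so ratios are never compared directly. The inequality between p-value and [alpha] is
   multiplied out, and the error at [u] is capped by the marginal density so that it stays
   integrable. Much of the work concerns measurability. The bounded Lipschitz distance is never
   shown to be a measurable function of the data; Markov's inequality acts through a measurable
   minorant of it. [lam] need not be sigma-finite and compact sets need not be measurable, so Fubini
   is applied to a restriction of [lam]. Joint measurability of the oracle p-value is drawn from
   equicontinuity. *)
Require Import Defs.
From Stdlib Require List.
From HB Require Import structures.
From mathcomp Require Import all_boot all_order all_algebra.
From mathcomp Require Import all_classical all_reals all_analysis.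
From mathcomp Require Import measurable_realfun.
From mathcomp Require Import ring lra.
Import Order.TTheory GRing.Theory Num.Theory.
Import numFieldNormedType.Exports.
Local Open Scope classical_set_scope.
Local Open Scope ring_scope.

(** * Mixtures of measures *)

Section mixture.
Local Open Scope ereal_scope.

(** The factor may be [+oo], as the weights of [mixture_measure] may be. Either [u] vanishes
    identically, or by monotonicity [+oo * u n] is [+oo] from some rank on. *)
Lemma nondecreasing_cvgeZl (R : realType) (c : \bar R) (u : (\bar R)^nat)
    (l : \bar R) :
  0 <= c -> (forall n, 0 <= u n) -> nondecreasing_seq u -> u @ \oo --> l ->
  (fun n => c * u n) @ \oo --> c * l.
Proof.
case: c => [c| |] // c0 u0 ndu ul; first exact: cvgeZl.
have [[n un]|nu] := pselect (exists n, 0 < u n).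
- have lu : forall m, u m <= l.
    move=> m; have -> : l = ereal_sup (range u).
      exact: cvg_unique ul (ereal_nondecreasing_cvgn ndu).
    by apply: ereal_sup_ubound; exists m.
  rewrite gt0_mulye; last exact: lt_le_trans (lu n).
  apply: cvg_near_cst; exists n => // m /= nm.
  by rewrite gt0_mulye//; apply: lt_le_trans (ndu _ _ nm).
- have u00 m : u m = 0.
    apply/eqP; rewrite eq_le u0 andbT leNgt; apply/negP => um; apply: nu.
    by exists m.
  have -> : l = 0.
    rewrite -(cvg_lim _ ul)// (_ : u = cst 0) ?lim_cst//.
    by apply/funext => m; rewrite u00.
  by rewrite (_ : (fun n => _) = cst (+oo * 0)) //;
    [exact: cvg_cst|apply/funext => m; rewrite u00].
Qed.

Context d1 d2 (X : measurableType d1) (Y : measurableType d2) (R : realType).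
Variables (mu : {measure set X -> \bar R}) (w : X -> \bar R).
Variable k : X -> {measure set Y -> \bar R}.
Hypothesis w0 : forall x, 0 <= w x.
Hypothesis mw : measurable_fun setT w.
Hypothesis mk : forall A, measurable A -> measurable_fun setT (k ^~ A).

Import HBNNSimple.

(** Serves four times: for the law of one unit, the joint law of [T] and [U] given [nu], the
    unnormalized posterior mean, and [lam] restricted to a set. As [mu] need not be sigma-finite,
    the formula for integrals comes from simple functions and monotone convergence. *)
Lemma mixture_measure : exists m : {measure set Y -> \bar R},
  (forall A, m A = \int[mu]_x (w x * k x A)) /\
  (forall f, (forall y, 0 <= f y) -> measurable_fun setT f ->
    \int[m]_y f y = \int[mu]_x (w x * \int[k x]_y f y)).
Proof.
pose m (A : set Y) := \int[mu]_x (w x * k x A).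
have m0 : m set0 = 0.
  by rewrite /m integral0_eq// => x _; rewrite measure0 mule0.
have m_ge0 A : 0 <= m A by apply: integral_ge0 => x _; exact: mule_ge0.
have msa : semi_sigma_additive m.
  move=> F mF tF mUF; rewrite /m.
  rewrite [X in X @ _](_ : _ = (fun n =>
      \int[mu]_x (w x * \sum_(0 <= i < n) k x (F i)))); last first.
    apply/funext => n; rewrite -ge0_integral_sum//.
    - apply: eq_integral => x _; rewrite ge0_sume_distrr//.
    - by move=> i; apply: emeasurable_funM => //; exact: mk.
    - by move=> i x _; exact: mule_ge0.
  rewrite [X in _ --> X](_ : _ = \int[mu]_x
      limn (fun n => w x * \sum_(0 <= i < n) k x (F i))).
    apply: cvg_monotone_convergence => //.
    - move=> n; apply: emeasurable_funM => //.
      by apply: emeasurable_sum => i; exact: mk.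
    - by move=> n x _; rewrite mule_ge0// sume_ge0.
    - move=> x _ a b ab; apply: lee_wpmul2l => //.
      exact: ereal_nondecreasing_series.
  apply: eq_integral => x _; apply/esym/cvg_lim => //.
  apply: nondecreasing_cvgeZl => //.
  - by move=> n; apply: sume_ge0.
  - exact: ereal_nondecreasing_series.
  - exact: measure_semi_sigma_additive.
pose M : {measure set Y -> \bar R} :=
  HB.pack m (isMeasure.Build _ _ _ m m0 m_ge0 msa).
exists M; split => // f f0 mf.
pose g := nnsfun_approx measurableT mf.
have mgE n : measurable_fun [set: Y] (fun y => (g n y)%:E).
  exact/measurable_EFinP.
have nd_g y : {homo (fun n => (g n y)%:E) : a b / (a <= b)%O >-> a <= b}.
  by move=> *; rewrite lee_fin; exact/lefP/nd_nnsfun_approx.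
have sE n : \int[M]_y (g n y)%:E = \int[mu]_x (w x * \int[k x]_y (g n y)%:E).
  rewrite integralT_nnsfun sintegralE.
  under [RHS]eq_integral do rewrite integralT_nnsfun sintegralE.
  under [RHS]eq_integral => x _.
    rewrite ge0_mule_fsumr; last by move=> r; exact: nnsfun_mulemu_ge0.
    under eq_fsbigr do rewrite muleCA.
    over.
  rewrite /=.
  have h0 r x : 0 <= r%:E * (w x * k x (g n @^-1` [set r])).
    rewrite muleCA; apply: mule_ge0 => //.
    exact: nnsfun_mulemu_ge0.
  have hm r : measurable_fun setT (fun x => w x * k x (g n @^-1` [set r])).
    by apply: emeasurable_funM => //; exact: mk.
  rewrite ge0_integral_fsum//; last first.
    by move=> r; apply: measurable_funeM.
  apply: eq_fsbigr => r /[!inE] -[y _ <-].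
  by rewrite ge0_integralZl//; [move=> x _; exact: mule_ge0|rewrite lee_fin].
have lim_g x : \int[k x]_y f y = limn (fun n => \int[k x]_y (g n y)%:E).
  rewrite -monotone_convergence//.
  - by apply: eq_integral => y _; apply/esym/cvg_lim => //; exact: cvg_nnsfun_approx.
  - by move=> n y _; rewrite lee_fin.
transitivity (limn (fun n => \int[M]_y (g n y)%:E)).
  rewrite -monotone_convergence//.
  - by apply: eq_integral => y _; apply/esym/cvg_lim => //; exact: cvg_nnsfun_approx.
  - by move=> n y _; rewrite lee_fin.
under eq_fun do rewrite sE.
have ndi x : nondecreasing_seq (fun n => \int[k x]_y (g n y)%:E).
  move=> a b ab; apply: ge0_le_integral => //.
  - by move=> y _; rewrite lee_fin.
  - by move=> y _; exact: nd_g.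
rewrite -monotone_convergence//.
- apply: eq_integral => x _; apply/cvg_lim => //.
  apply: nondecreasing_cvgeZl => //.
  + by move=> n; apply: integral_ge0 => y _; rewrite lee_fin.
  + rewrite lim_g; exact: ereal_nondecreasing_is_cvgn.
- move=> n; apply: emeasurable_funM => //.
  apply: measurable_fun_integral_kernel => //.
  by move=> z; rewrite lee_fin.
- by move=> n x _; apply: mule_ge0 => //; apply: integral_ge0 => y _; rewrite lee_fin.
- by move=> x _ a b ab; apply: lee_wpmul2l => //; exact: ndi.
Qed.

End mixture.

(** * Finite nets and measurability on a compact metric space *)

Section compact_metric.
Context {R : realType} {V : pointedType} (d : V -> V -> R).
Hypothesis md : is_metric d.
Hypothesis cd : dcompact_space d.

Lemma dball_dopen x e : dopen d [set y | d x y < e].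
Proof.
case: md => _ _ _ tri y /= xy; exists (e - d x y); first by rewrite subr_gt0.
by move=> z yz; rewrite (le_lt_trans (tri x y z))// -ltrBrDl.
Qed.

Lemma dopen_measurable (A : set (Vm d)) : dopen d A -> measurable A.
Proof. exact: sub_sigma_algebra. Qed.

Lemma dcontinuous_measurable (f : Vm d -> R) :
  (forall x e, 0 < e -> exists2 delta : R, 0 < delta &
     forall y, d x y < delta -> `|f x - f y| < e) ->
  measurable_fun setT f.
Proof.
move=> cf; apply: (measurability _ (RGenOInfty.measurableE R)) => _ [_ [r ->] <-].
rewrite setTI; apply: dopen_measurable => x /=; rewrite in_itv/= andbT => rx.
have [|dl dl0 h] := cf x (f x - r); first by rewrite subr_gt0.
exists dl => // y /h; rewrite in_itv/= andbT.
by rewrite ltr_distlC => /andP[+ _]; rewrite opprB addrC subrK.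
Qed.

(** The radius varies with the centre so that [equicontinuous_uniform] can use the modulus of
    continuity at each centre. *)
Lemma finite_net (e : V -> R) : (forall x, 0 < e x) ->
  exists s : seq V, forall x, exists2 y, y \in (s : seq {classic V}) & d y x < e y.
Proof.
move=> e0; case: md => d0 dxx _ _.
have [] := cd [set [set y | d x y < e x] | x in setT].
- by move=> _ [x _ <-]; exact: dball_dopen.
- move=> x _; exists [set y | d x y < e x]; first by exists x.
  by rewrite /= (dxx x x).2.
move=> k [F [FC cover]].
have /choice[c hc] i : exists x, [set y | d x y < e x] = F i.
  by have [x _ <-] := FC i; exists x.
exists [seq c i | i <- enum 'I_k] => x.
have [i _ Fx] := cover x Logic.I.
exists (c i); first by apply/mapP; exists i => //; rewrite mem_enum.
by move: Fx; rewrite -hc.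
Qed.

End compact_metric.

(** * Integrals against bare set functions and of non-measurable functions *)

Section integral_lower.
Import HBNNSimple.

(** [postmean] is a bare set function. Simple functions have measurable level sets, so integrals see
    only its values on measurable sets. *)
Lemma setfun_eq_integral dT (T : measurableType dT) (R : realType)
   (m1 m2 : set T -> \bar R) (f : T -> \bar R) :
  (forall A, measurable A -> m1 A = m2 A) ->
  (\int[m1]_x f x = \int[m2]_x f x)%E.
Proof.
move=> m12; rewrite /integral; congr (_ - _)%E; congr ereal_sup;
  apply/seteqP; split => _ [h hf <-]; exists h => //;
  rewrite /sintegral; apply: eq_fsbigr => r _;
    by [rewrite m12//|rewrite -m12//].
Qed.

(** Holds without measurability: for nonnegative functions the integral is a supremum over the
    simple functions below. *)
Lemma nonneg_le_integral dT (T : measurableType dT) (R : realType)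
   (m : {measure set T -> \bar R}) (f g : T -> \bar R) :
  (forall x, 0 <= f x)%E -> (forall x, f x <= g x)%E ->
  (\int[m]_x f x <= \int[m]_x g x)%E.
Proof.
move=> f0 fg; rewrite !ge0_integralTE//; last first.
  by move=> x; exact: le_trans (fg x).
apply: le_ereal_sup => _ [h hf <-]; exists h => // x.
exact: le_trans (fg x).
Qed.

End integral_lower.

Section equicontinuous_measurable.
Context {R : realType} {V : pointedType} (d : V -> V -> R).
Hypothesis md : is_metric d.
Hypothesis cd : dcompact_space d.

(** [h] is the limit of [g n], which replaces [nu] by the first point of a finite net at distance
    less than [dl n]; each [g n] is a finite nest of measurable tests. *)
Lemma equicontinuous_measurable dO (O : measurableType dO) (h : O -> Vm d -> R) :
  (forall nu, measurable_fun setT (h ^~ nu)) ->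
  (forall e, 0 < e -> exists2 delta : R, 0 < delta &
     forall o nu nu', d nu nu' < delta -> `|h o nu - h o nu'| < e) ->
  measurable_fun setT (fun x : (O * Vm d)%type => h x.1 x.2).
Proof.
move=> mh eh.
have md' : forall x y, d x y = d y x by case: md.
have /choice[dl hdl] (n : nat) : exists dl : R, 0 < dl /\
    forall o nu nu', d nu nu' < dl -> `|h o nu - h o nu'| < n.+1%:R^-1.
  by have [|dl ? ?] := eh n.+1%:R^-1; [rewrite invr_gt0|exists dl].
have /choice[s hs] (n : nat) := finite_net _ md cd (fun _ => dl n) (fun _ => (hdl n).1).
pose g n (l : seq V) (x : (O * Vm d)%type) : R :=
  foldr (fun y a => if d x.2 y < dl n then h x.1 y else a) 0 l.
have mg n l : measurable_fun setT (g n l).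
  elim: l => [|y l IH]; first exact: measurable_cst.
  rewrite /g /=; apply: measurable_fun_ifT => //.
  - apply: measurable_fun_ltr => //.
    have mdy : measurable_fun setT (fun v : Vm d => d v y).
      apply: (dcontinuous_measurable d) => x e e0; exists e => // z xz.
      case: md => d0 dxx sym tri; apply: le_lt_trans xz.
      rewrite ler_distlC lerBlDl; apply/andP; split; first exact: tri.
      by rewrite addrC (sym x z) tri.
    exact: measurableT_comp mdy measurable_snd.
  - exact: measurableT_comp (mh y) measurable_fst.
apply: (measurable_fun_cvg (fun n => mg n (s n))) => -[w nu] _ /=.
apply/cvgrPdist_lt => e e0; near=> n.
have [y ys yd] := hs n nu; rewrite (md' y nu) in yd.
have [z zd gz] : exists2 z, d nu z < dl n & g n (s n) (w, nu) = h w z.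
  elim: (s n) ys => // a l IH; rewrite inE /g /=; case: ifPn => [ad _|ad].
    by exists a.
  move/predU1P => [ya|/IH//]; by rewrite -ya yd in ad.
rewrite gz; apply: lt_trans ((hdl n).2 _ _ _ zd) _.
near: n.
have := near_infty_natSinv_lt (PosNum e0); exact: filterS.
Unshelve. all: by end_near. Qed.

End equicontinuous_measurable.

(** * Iterated integrals over a sample *)

Section iterated_integral.
Local Open Scope ereal_scope.
Context {R : realType}.

(** Takes the place of a product measure on samples. The laws form a list because they vary with the
    primary parameter of the unit. *)
Fixpoint iterint {dX} {X : measurableType dX} (L : seq (probability X R))
    (F : seq X -> \bar R) : \bar R :=
  if L is P :: L' then \int[P]_x iterint L' (fun s => F (x :: s)) else F [::].

(* Measurability of a function on sequences of length [k]: there is no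
   sigma-algebra on [seq X], so measurability is tested along all measurable
   families [ys] of [k] random elements, indexed by an arbitrary space. *)
Definition mseqfun {dX} {X : measurableType dX} {dO} {O : measurableType dO}
    (k : nat) (F : O -> seq X -> \bar R) : Prop :=
  forall dO' (O' : measurableType dO') (g : O' -> O) (ys : seq (O' -> X)),
    measurable_fun setT g -> (forall y, List.In y ys -> measurable_fun setT y) ->
    size ys = k -> measurable_fun setT (fun o => F (g o) [seq y o | y <- ys]).

Context {dX} {X : measurableType dX}.
Implicit Types (L : seq (probability X R)) (P : probability X R).

Lemma eq_iterint L F G : (forall s, size s = size L -> F s = G s) ->
  iterint L F = iterint L G.
Proof.
elim: L F G => [|P L IH] F G FG /=; first exact: FG.
by apply: eq_integral => x _; apply: IH => s sL; rewrite FG//= sL.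
Qed.

Lemma iterint_ge0 L F : (forall s, 0 <= F s) -> 0 <= iterint L F.
Proof.
by elim: L F => [|P L IH] F F0 //=; apply: integral_ge0 => x _; exact: IH.
Qed.

Lemma mseqfun_cons dO (O : measurableType dO) k (F : O -> seq X -> \bar R) :
  mseqfun k.+1 F -> mseqfun k (fun (x : (O * X)%type) s => F x.1 (x.2 :: s)).
Proof.
move=> mF dO' O' g ys mg mys sz.
apply: (mF _ O' (fst \o g) ((snd \o g) :: ys)).
- exact: measurableT_comp.
- by move=> y /= [<-|/mys//]; exact: measurableT_comp.
- by rewrite /= sz.
Qed.

Lemma mseqfun_comp dO (O : measurableType dO) d1 (O1 : measurableType d1) k
    (F : O -> seq X -> \bar R) (g : O1 -> O) :
  measurable_fun setT g -> mseqfun k F -> mseqfun k (fun o => F (g o)).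
Proof.
move=> mg mF dO' O' g' ys mg' mys sz.
by apply: (mF _ _ (g \o g')) => //; exact: measurableT_comp.
Qed.

Lemma mseqfun_cons_cst dO (O : measurableType dO) k (F : O -> seq X -> \bar R) x :
  mseqfun k.+1 F -> mseqfun k (fun o s => F o (x :: s)).
Proof.
by move=> /mseqfun_cons; apply: (mseqfun_comp _ _ _ _ _ _ (fun o => (o, x))).
Qed.

Lemma mseqfun_section dO (O : measurableType dO) k (F : O -> seq X -> \bar R) o :
  mseqfun k.+1 F -> mseqfun k (fun x s => F o (x :: s)).
Proof.
move=> /mseqfun_cons; apply: (mseqfun_comp _ _ _ _ _ _ (fun x => (o, x))).
exact: measurable_fun_pair.
Qed.

(** [O] is arbitrary because the induction moves the head of the sequence into it, passing from [O]
    to [O * X]. *)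
Lemma iterint_measurable dO (O : measurableType dO) L (F : O -> seq X -> \bar R) :
  (forall o s, 0 <= F o s) -> mseqfun (size L) F ->
  measurable_fun setT (fun o => iterint L (F o)).
Proof.
elim: L dO O F => [|P L IH] dO O F F0 mF /=.
  exact: (mF _ O id [::]).
apply: (measurable_fun_fubini_tonelli_F
  (fun x : (O * X)%type => iterint L (fun s => F x.1 (x.2 :: s)))).
  by apply: (IH _ _ (fun (x : (O * X)%type) s => F x.1 (x.2 :: s))) => //;
    exact: mseqfun_cons.
by move=> x; exact: iterint_ge0.
Qed.

Lemma integral_iterint L P (G : X -> seq X -> \bar R) :
  (forall x s, 0 <= G x s) -> mseqfun (size L) G ->
  \int[P]_x iterint L (G x) = iterint L (fun s => \int[P]_x G x s).
Proof.
elim: L G => [|Q L IH] G G0 mG //=.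
rewrite (fubini_tonelli (fun x : (X * X)%type => iterint L (fun s => G x.1 (x.2 :: s))))//=.
- apply: eq_integral => y _.
  by apply: (IH (fun x s => G x (y :: s))) => //; exact: mseqfun_cons_cst.
- apply: (iterint_measurable _ _ _ (fun (x : (X * X)%type) s => G x.1 (x.2 :: s))) => //.
  exact: mseqfun_cons.
- by move=> x; exact: iterint_ge0.
Qed.

(** Tonelli carries the integral of the unit at position [i] inside those of the units after it;
    this is how conditioning on the other units is expressed. *)
Lemma iterint_insert dO (O : measurableType dO) L P i (F : O -> seq X -> \bar R) o :
  (forall o s, 0 <= F o s) -> mseqfun (size L).+1 F ->
  iterint (take i L ++ P :: drop i L) (F o) =
  iterint L (fun s => \int[P]_x F o (take i s ++ x :: drop i s)).
Proof.
elim: i L dO O F o => [|i IH] [|Q L] dO O F o F0 mF //.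
- under [RHS]eq_iterint do under eq_integral do rewrite take0 drop0 /=.
  rewrite take0 drop0 cat0s [LHS]/=.
  apply: (integral_iterint (Q :: L) P (fun x s => F o (x :: s))) => //.
  exact: mseqfun_section.
- rewrite /=; apply: eq_integral => y _.
  apply: (IH L _ _ (fun o s => F o (y :: s)) o) => //.
  exact: mseqfun_cons_cst.
Qed.

Lemma iterint_affine dO (O : measurableType dO) L (F : O -> seq X -> \bar R) o
    (a b : R) :
  (0 <= a)%R -> (0 <= b)%R -> (forall o s, 0 <= F o s) -> mseqfun (size L) F ->
  iterint L (fun s => a%:E + b%:E * F o s) = a%:E + b%:E * iterint L (F o).
Proof.
move=> a0 b0; elim: L dO O F o => [//|P L IH] dO O F o F0 mF /=.
have mF' : measurable_fun setT (fun x => iterint L (fun s => F o (x :: s))).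
  apply: (iterint_measurable _ _ _ (fun x s => F o (x :: s))) => //.
  exact: mseqfun_section.
under eq_integral => x _.
  rewrite (IH _ _ (fun o s => F o (x :: s)) o)//; last exact: mseqfun_cons_cst.
  over.
have F0' x : 0 <= iterint L (fun s => F o (x :: s)) by exact: iterint_ge0.
rewrite ge0_integralD//.
- rewrite ge0_integralZl_EFin// integral_cst// [X in _ * X]probability_setT mule1//.
- by move=> x _; rewrite mule_ge0.
- exact: measurable_funeM.
Qed.

Lemma iterint_add dO (O : measurableType dO) L (F G : O -> seq X -> \bar R) o :
  (forall o s, 0 <= F o s) -> (forall o s, 0 <= G o s) ->
  mseqfun (size L) F -> mseqfun (size L) G ->
  iterint L (fun s => F o s + G o s) = iterint L (F o) + iterint L (G o).
Proof.
elim: L dO O F G o => [//|P L IH] dO O F G o F0 G0 mF mG /=.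
under eq_integral => x _.
  rewrite (IH _ _ (fun o s => F o (x :: s)) (fun o s => G o (x :: s)) o)//;
    [|exact: mseqfun_cons_cst|exact: mseqfun_cons_cst].
  over.
rewrite ge0_integralD//.
- by move=> x _; exact: iterint_ge0.
- apply: (iterint_measurable _ _ _ (fun x s => F o (x :: s))) => //.
  exact: mseqfun_section.
- by move=> x _; exact: iterint_ge0.
- apply: (iterint_measurable _ _ _ (fun x s => G o (x :: s))) => //.
  exact: mseqfun_section.
Qed.

Lemma iterint_le dO (O : measurableType dO) L (F G : O -> seq X -> \bar R) o :
  (forall o s, 0 <= F o s) -> (forall o s, F o s <= G o s) ->
  iterint L (F o) <= iterint L (G o).
Proof.
move=> F0 FG; elim: L dO O F G o F0 FG => [|P L IH] dO O F G o F0 FG /=.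
  exact: FG.
apply: nonneg_le_integral; first by move=> x; exact: iterint_ge0.
by move=> x; apply: (IH _ _ (fun o s => F o (x :: s)) (fun o s => G o (x :: s))).
Qed.

End iterated_integral.

Section iterated_integral_map.
Local Open Scope ereal_scope.
Context {R : realType}.

(** Removes the primary parameters: the laws in [L] differ from unit to unit, but their images under
    [phi], in the application the marginal laws of [U], coincide. *)
Lemma iterint_map dX (X : measurableType dX) dY (Y : measurableType dY)
    (phi : X -> Y) (m : probability Y R)
    (L : seq (probability X R)) dO (O : measurableType dO) (G : O -> seq Y -> \bar R) o :
  measurable_fun setT phi ->
  (forall P, List.In P L -> forall B, measurable B -> P (phi @^-1` B) = m B) ->
  (forall o s, 0 <= G o s) -> mseqfun (size L) G ->
  iterint L (fun s => G o (map phi s)) = iterint (nseq (size L) m) (G o).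
Proof.
move=> mphi; elim: L dO O G o => [//|P L IH] dO O G o hL G0 mG /=.
under eq_integral => x _.
  rewrite (IH _ _ (fun o s => G o (phi x :: s)) o)//;
    [|by move=> Q QL; apply: hL; right|exact: mseqfun_cons_cst].
  over.
have mf : measurable_fun setT
    (fun y => iterint (nseq (size L) m) (fun s => G o (y :: s))).
  apply: (iterint_measurable _ _ _ (fun y s => G o (y :: s))) => //.
  rewrite size_nseq.
  exact: mseqfun_section.
have -> : \int[m]_y iterint (nseq (size L) m) (fun s => G o (y :: s)) =
    \int[pushforward P phi]_y iterint (nseq (size L) m) (fun s => G o (y :: s)).
  apply: eq_measure_integral => B mB _.
  by rewrite /= /pushforward hL//; left.
rewrite ge0_integral_pushforward//.
by move=> y _; exact: iterint_ge0.
Qed.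

End iterated_integral_map.

(** * The bounded Lipschitz distance *)

Section bounded_lipschitz.
Context {R : realType} {V : pointedType} (d : V -> V -> R).
Hypothesis md : is_metric d.
Hypothesis cd : dcompact_space d.

(** Lebesgue number: balls of half the modulus at their centre cover [V], and [dd] is at most each
    of these finitely many half radii, so nearby points lie within the full modulus of a common
    centre. *)
Lemma equicontinuous_uniform (I : Type) (D : set I) (h : I -> V -> R) :
  (forall nu e, 0 < e -> exists2 delta : R, 0 < delta &
     forall i nu', D i -> d nu nu' < delta -> `|h i nu - h i nu'| < e) ->
  forall e, 0 < e -> exists2 delta : R, 0 < delta &
     forall i nu nu', D i -> d nu nu' < delta -> `|h i nu - h i nu'| < e.
Proof.
move=> eh e e0.
have e20 : 0 < e / 2 by rewrite divr_gt0.
have /choice[dl hdl] nu : exists dl : R, 0 < dl /\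
    forall i nu', D i -> d nu nu' < dl -> `|h i nu - h i nu'| < e / 2.
  by have [dl ? ?] := eh nu _ e20; exists dl.
have dl20 nu : 0 < dl nu / 2 by rewrite divr_gt0// (hdl nu).1.
have [s hs] := finite_net d md cd (fun nu => dl nu / 2) dl20.
have [dd dd0 hdd] : exists2 dd : R, 0 < dd &
    forall y, y \in (s : seq {classic V}) -> dd <= dl y / 2.
  elim: (s) => [|a l [dd dd0 hl]]; first by exists 1.
  exists (Num.min dd (dl a / 2)); first by rewrite lt_min dd0 dl20.
  move=> y; rewrite inE => /predU1P[->|/hl yl]; first by rewrite ge_min lexx orbT.
  by rewrite ge_min yl.
exists dd => // i nu nu' Di nn'.
have [y ys yd] := hs nu.
have dy := (hdl y).2 i _ Di.
have h1 : `|h i y - h i nu| < e / 2.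
  by apply: dy; rewrite (lt_le_trans yd)// ler_pdivrMr// ler_peMr ?ler1n// ltW// (hdl y).1.
have h2 : `|h i y - h i nu'| < e / 2.
  apply: dy; case: md => _ _ _ tri; rewrite (le_lt_trans (tri y nu nu'))//.
  by rewrite (splitr (dl y)) ltrD// (lt_le_trans nn')// hdd.
rewrite (splitr e) (le_lt_trans _ (ltrD h1 h2))//.
by rewrite (distrC (h i y) (h i nu)); exact: ler_distD.
Qed.

(** [psi] is the infimal convolution of [phi] with [M / delta * d]. Beyond distance [delta] the
    penalty is at least [M >= phi x], so only points where [phi] is within [e] of [phi x] can push
    the infimum below [phi x]. *)
Lemma lipschitz_minorant (phi : V -> R) (M e delta : R) :
  0 <= e -> 0 < delta -> (forall x, 0 <= phi x <= M) ->
  (forall x y, d x y < delta -> `|phi x - phi y| <= e) ->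
  exists2 psi : V -> R, forall x, [/\ 0 <= psi x, psi x <= phi x & phi x <= psi x + e] &
    forall x y, `|psi x - psi y| <= M / delta * d x y.
Proof.
move=> e0 dl0 phiM phie; case: md => d0 dxx sym tri.
have M0 : 0 <= M by have /andP[h1 h2] := phiM point; exact: le_trans h2.
have L0 : 0 <= M / delta by rewrite divr_ge0// ltW.
pose S x := [set phi y + M / delta * d x y | y in setT].
have Sn x : S x !=set0 by exists (phi x + M / delta * d x x); exists x.
have S0 x : lbound (S x) 0.
  move=> _ [y _ <-]; apply: addr_ge0; first by case/andP: (phiM y).
  exact: mulr_ge0.
have Sb x : has_lbound (S x) by exists 0.
exists (fun x => inf (S x)) => [x|x y].
  split.
  - by apply: lb_le_inf.
  - apply: ge_inf => //; exists x => //.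
    by rewrite (dxx x x).2// mulr0 addr0.
  - rewrite -lerBlDr; apply: lb_le_inf => // _ [y _ <-].
    have [xy|xy] := ltP (d x y) delta.
      have := phie _ _ xy; rewrite ler_distl => /andP[_ h].
      by rewrite lerBlDr (le_trans h)// -addrA lerD2l [leRHS]addrC lerDl mulr_ge0.
    rewrite lerBlDr -[leLHS]addr0 lerD//.
    have /andP[_ h] := phiM x; rewrite (le_trans h)//.
    have /andP[h' _] := phiM y; rewrite -[leLHS]add0r lerD//.
    by rewrite -[leLHS](divfK (lt0r_neq0 dl0)) ler_wpM2l.
have hL a b : inf (S a) - inf (S b) <= M / delta * d a b.
  rewrite lerBlDr -lerBlDl; apply: lb_le_inf => // _ [z _ <-].
  rewrite lerBlDl; apply: (@le_trans _ _ (phi z + M / delta * d a z)).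
    by apply: ge_inf => //; exists z.
  by rewrite addrCA lerD2l -mulrDr ler_wpM2l.
rewrite ler_norml hL andbT lerNl opprB (sym x y); exact: hL.
Qed.

(** [K] bounds the sup norm and the Lipschitz constant of the minorant [psi], so [psi / K] is a test
    function. The approximation error [e] is paid under [m1] only; the reverse bound follows by
    exchanging the measures. *)
Lemma integral_le_BL1 (m1 m2 : {measure set (Vm d) -> \bar R})
    (phi : Vm d -> R) (M e delta r K : R) :
  m1 setT = 1%E -> m2 setT = 1%E ->
  0 <= e -> 0 < delta -> (forall x, 0 <= phi x <= M) ->
  (forall x y, d x y < delta -> `|phi x - phi y| <= e) ->
  measurable_fun setT phi ->
  0 < K -> M <= K -> M / delta <= K ->
  (forall psi, BL1 d psi ->
    `|(\int[m1]_x (psi x)%:E) - (\int[m2]_x (psi x)%:E)| <= r%:E)%E ->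
  (\int[m1]_x (phi x)%:E <= \int[m2]_x (phi x)%:E + (K * r + e)%:E)%E.
Proof.
move=> m11 m21 e0 dl0 phiM phie mphi K0 MK LK hr.
have d0 : forall x y, 0 <= d x y by case: md.
have [psi hpsi psiL] := lipschitz_minorant phi M e delta e0 dl0 phiM phie.
have psi0 x : 0 <= psi x by case: (hpsi x).
have psiK x : psi x <= K.
  by have [_ h _] := hpsi x; apply: (le_trans h); have /andP[_ /le_trans->] := phiM x.
have mpsi : measurable_fun setT (psi : Vm d -> R).
  apply: (dcontinuous_measurable d) => x e1 e10; exists (e1 / K); first by rewrite divr_gt0.
  move=> y xy; rewrite (le_lt_trans (psiL x y))//.
  by rewrite (le_lt_trans (y := K * d x y)) ?ler_wpM2r// mulrC -ltr_pdivlMr.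
pose psi' (x : V) := K^-1 * psi x.
have Ki0 : 0 <= K^-1 by rewrite invr_ge0 ltW.
have psi'0 x : 0 <= psi' x by rewrite mulr_ge0.
have psi'1 x : psi' x <= 1 by rewrite ler_pdivrMl// mulr1.
have mpsi' : measurable_fun setT (psi' : Vm d -> R) by exact: measurable_funM.
have BLpsi : BL1 d psi'.
  split => [x|x y]; first by rewrite ger0_norm.
  rewrite -mulrBr normrM ger0_norm// ler_pdivrMl//.
  by rewrite (le_trans (psiL x y))// ler_wpM2r.
have := hr _ BLpsi.
have psiE (m : {measure set (Vm d) -> \bar R}) :
    (\int[m]_x (psi x)%:E = K%:E * \int[m]_x (psi' x)%:E)%E.
  rewrite -ge0_integralZl_EFin//.
  - by apply: eq_integral => x _; rewrite -EFinM mulVKf// gt_eqF.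
  - by move=> x _; rewrite lee_fin.
  - exact/measurable_EFinP.
  - exact: ltW.
have fin_psi (m : {measure set (Vm d) -> \bar R}) : m setT = 1%E ->
    (\int[m]_x (psi' x)%:E)%E \is a fin_num.
  move=> m1T; rewrite ge0_fin_numE; last by apply: integral_ge0 => x _; rewrite lee_fin.
  apply: (@le_lt_trans _ _ (\int[m]_x (cst 1%:E) x)%E).
    apply: ge0_le_integral => //.
    - by move=> x _; rewrite lee_fin.
    - exact/measurable_EFinP.
    - by move=> x _; rewrite lee_fin.
  by rewrite integral_cst// [X in (_ * X)%E]m1T mule1 ltry.
have [/fineK <- /fineK <-] := (fin_psi _ m11, fin_psi _ m21).
rewrite -EFinB lee_fin ler_distl => /andP[_ h].
apply: (@le_trans _ _ (\int[m1]_x ((psi x)%:E + (cst e%:E) x))%E).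
  apply: ge0_le_integral => //.
  - by move=> x _; rewrite lee_fin; case/andP: (phiM x).
  - exact/measurable_EFinP.
  - by apply: emeasurable_funD => //; exact/measurable_EFinP.
  - by move=> x _; rewrite -EFinD lee_fin; case: (hpsi x).
rewrite ge0_integralD//; last first.
- exact/measurable_EFinP.
- by move=> x _; rewrite lee_fin.
rewrite integral_cst// [X in (_ + _ * X)%E]m11 mule1 EFinD addeA leeD2r//.
apply: (@le_trans _ _ (\int[m2]_x (psi x)%:E + (K * r)%:E)%E).
  rewrite !psiE -(fineK (fin_psi _ m11)) -(fineK (fin_psi _ m21)) -!EFinM -EFinD.
  by rewrite lee_fin -mulrDr ler_pM2l.
rewrite leeD2r//; apply: ge0_le_integral => //.
- by move=> x _; rewrite lee_fin.
- exact/measurable_EFinP.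
- exact/measurable_EFinP.
- by move=> x _; rewrite lee_fin; case: (hpsi x).
Qed.

End bounded_lipschitz.

(** * Tails of absolutely continuous laws *)

Section absolutely_continuous_tail.
Local Open Scope ereal_scope.
Context {R : realType}.

Lemma measurable_tail (t : R) : measurable [set x : R | (`|t| <= `|x|)%R].
Proof.
have mf : measurable_fun setT (fun x : R => `|x|%R) by exact: normr_measurable.
have := mf measurableT `[`|t|%R, +oo[%classic (measurable_itv _).
rewrite setTI (_ : _ @^-1` _ = [set x : R | (`|t| <= `|x|)%R])//.
by apply/seteqP; split => x /=; rewrite in_itv/= andbT.
Qed.

Variable P : probability R R.
Hypothesis acP : P `<< (@lebesgue_measure R).

Definition upset (E : set R) := forall x y, E x -> (`|x| <= `|y|)%R -> E y.

Lemma null_point (a : R) : P [set a] = 0.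
Proof.
have /null_content_dominatesP := acP; apply; first exact: measurable_set1.
exact: lebesgue_measure_set1.
Qed.

(** [E] and the closed tail differ at most in the points [c] and [-c], which are null. *)
Lemma measure_upset (E : set R) (c : R) : measurable E -> (0 <= c)%R ->
  (forall t, (c < `|t|)%R -> E t) -> (forall t, E t -> (c <= `|t|)%R) ->
  P E = P [set x | (`|c| <= `|x|)%R].
Proof.
move=> mE c0 cE Ec; have mc := measurable_tail c.
apply/eqP; rewrite eq_le; apply/andP; split.
  by apply: le_measure; rewrite ?inE// => t /Ec; rewrite /= (ger0_norm c0).
have sub : [set x | (`|c| <= `|x|)%R] `<=` E `|` ([set c] `|` [set (- c)%R]).
  move=> x /=; rewrite (ger0_norm c0) le_eqVlt => /orP[/eqP cx|/cE]; last by left.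
  right; have [x0|x0] := leP 0%R x; [left|right] => /=.
    by rewrite cx ger0_norm.
  by rewrite cx ltr0_norm// opprK.
have mcc : measurable ([set c] `|` [set (- c)%R] : set R).
  by apply: measurableU; exact: measurable_set1.
have mEcc : measurable (E `|` ([set c] `|` [set (- c)%R] : set R)) by exact: measurableU.
apply: (@le_trans _ _ (P (E `|` ([set c] `|` [set (- c)%R])))).
  by apply: le_measure; rewrite ?inE.
apply: le_trans (measureU2 _ mE mcc) _.
rewrite -[leRHS]adde0 leeD2l//.
apply: le_trans (measureU2 _ (measurable_set1 _) (measurable_set1 _)) _.
by rewrite [X in X + _]null_point [X in _ + X]null_point adde0.
Qed.

Lemma tail_cvg_right (E : set R) (c : R) : measurable E -> (0 <= c)%R ->
  (forall t, (c < `|t|)%R -> E t) -> (forall t, E t -> (c <= `|t|)%R) ->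
  (fun n => P [set x | (`|c + n.+1%:R^-1| <= `|x|)%R]) @ \oo --> P E.
Proof.
move=> mE c0 cE Ec.
pose F n := [set x : R | (`|c + n.+1%:R^-1| <= `|x|)%R].
have FE : \bigcup_n F n = [set x | (c < `|x|)%R].
  apply/seteqP; split => [x [n _]|x /= cx]; rewrite /F/=.
    apply: lt_le_trans; rewrite ger0_norm ?addr_ge0//.
    by rewrite ltrDl invr_gt0.
  have xc0 : (0 < `|x| - c)%R by rewrite subr_gt0.
  have [n _ /(_ n (leqnn n)) /= h] := near_infty_natSinv_lt (PosNum xc0).
  exists n => //=; rewrite ger0_norm ?addr_ge0//.
  by rewrite addrC -lerBrDr ltW.
have mF n : measurable (F n) by exact: measurable_tail.
have mcup : measurable (\bigcup_n F n) by exact: bigcup_measurable.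
have -> : P E = P (\bigcup_n F n).
  rewrite FE in mcup *; rewrite (measure_upset E c)// (measure_upset [set x | (c < `|x|)%R] c)//.
  by move=> t /= /ltW.
apply: nondecreasing_cvg_mu => //.
move=> a b ab; apply/subsetPset => x; rewrite /F/=; apply: le_trans.
by rewrite !ger0_norm ?addr_ge0// lerD2l lef_pV2 ?posrE// ler_nat.
Qed.

(** The truncation at [0] matters because a tail depends on the absolute value of its threshold: for
    small [c], [|c - n.+1%:R^-1|] may exceed [c]. *)
Lemma tail_cvg_left (E : set R) (c : R) : measurable E -> (0 < c)%R ->
  (forall t, (c < `|t|)%R -> E t) -> (forall t, E t -> (c <= `|t|)%R) ->
  (fun n => P [set x | (`|Num.max 0 (c - n.+1%:R^-1)| <= `|x|)%R]) @ \oo --> P E.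
Proof.
move=> mE c0 cE Ec.
pose F n := [set x : R | (`|Num.max 0 (c - n.+1%:R^-1)| <= `|x|)%R].
have m0 n : (0 <= Num.max 0 (c - n.+1%:R^-1) :> R)%R by rewrite le_max lexx.
have FE : \bigcap_n F n = [set x | (`|c| <= `|x|)%R].
  apply/seteqP; split => [x Fx|x /= cx n _]; rewrite /F/=; last first.
    apply: le_trans cx; rewrite !ger0_norm ?(ltW c0)// ge_max (ltW c0)/=.
    by rewrite lerBlDr lerDl.
  rewrite ger0_norm ?(ltW c0)// leNgt; apply/negP => xc.
  have xc0 : (0 < c - `|x|)%R by rewrite subr_gt0.
  have [n _ /(_ n (leqnn n)) /= h] := near_infty_natSinv_lt (PosNum xc0).
  have := Fx n Logic.I; rewrite /F/= ger0_norm// leNgt => /negP; apply.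
  by rewrite lt_max; apply/orP; right; rewrite ltrBrDr -ltrBrDl.
have mF n : measurable (F n) by exact: measurable_tail.
have mcap : measurable (\bigcap_n F n) by exact: bigcap_measurable.
rewrite (measure_upset E c)// ?(ltW c0)// -FE.
apply: nonincreasing_cvg_mu => //.
- exact: le_lt_trans (probability_le1 _ (mF 0%N)) (ltry 1).
- move=> a b ab; apply/subsetPset => x; rewrite /F/=; apply: le_trans.
  rewrite !ger0_norm// ge_max !le_max lexx/= lerD2l lerN2 lef_pV2 ?posrE//.
  by rewrite ler_nat ltnS ab orbT.
Qed.

Lemma tail_cvg_infty :
  (fun n => P [set x | (`|n%:R| <= `|x|)%R]) @ \oo --> 0.
Proof.
pose F n := [set x : R | (`|n%:R| <= `|x|)%R].
have FE : \bigcap_n F n = set0.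
  apply/seteqP; split => // x Fx.
  have := Fx (Num.truncn `|x|).+1 Logic.I; rewrite /F/= ger0_norm//.
  by rewrite leNgt truncnS_gt.
have mF n : measurable (F n) by exact: measurable_tail.
have mcap : measurable (\bigcap_n F n) by exact: bigcap_measurable.
rewrite -(measure0 P) -FE.
apply: nonincreasing_cvg_mu => //.
- exact: le_lt_trans (probability_le1 _ (mF 0%N)) (ltry 1).
- move=> a b ab; apply/subsetPset => x; rewrite /F/=; apply: le_trans.
  by rewrite !ger0_norm// ler_nat.
Qed.

End absolutely_continuous_tail.

Lemma upset_threshold (R : realType) (E : set R) : upset E -> E = set0 \/
  exists c : R, [/\ 0 <= c, forall t, c < `|t| -> E t & forall t, E t -> c <= `|t|].
Proof.
move=> upE; have [->|/set0P[t0 Et0]] := eqVneq E set0; [by left|right].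
pose S := [set `|t| | t in E].
have S0 : S !=set0 by exists `|t0|; exists t0.
have Sb : lbound S 0 by move=> _ [t _ <-].
exists (inf S); split.
- exact: lb_le_inf.
- move=> t ct; have [_ [s Es <-] st] := inf_lt S0 ct.
  exact: upE Es (ltW st).
- by move=> t Et; apply: ge_inf; [exists 0|exists t].
Qed.

Section mixture_upset.
Local Open Scope ereal_scope.
Context {R : realType} dN (N : measurableType dN).
Variables (G : probability N R) (K : N -> probability R R) (w : N -> R) (M : R).
Hypothesis acK : forall nu, K nu `<< (@lebesgue_measure R).
Hypothesis mK : forall t : R,
  measurable_fun setT (fun nu => K nu [set x | (`|t| <= `|x|)%R]).
Hypothesis mw : measurable_fun setT w.
Hypothesis w0M : forall nu, (0 <= w nu <= M)%R.

Let N_ (t : R) := \int[G]_nu (K nu [set x | (`|t| <= `|x|)%R] * (w nu)%:E).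

Let N_cvg (t : R^nat) (L : N -> \bar R) :
  (forall nu, (fun n => K nu [set x | (`|t n| <= `|x|)%R]) @ \oo --> L nu) ->
  (fun n => N_ (t n)) @ \oo --> \int[G]_nu (L nu * (w nu)%:E).
Proof.
move=> tL.
apply: (@dominated_cvg _ _ _ G setT measurableT
   (fun n nu => K nu [set x | (`|t n| <= `|x|)%R] * (w nu)%:E) _
   (fun nu => (cst M%:E) nu)).
- by move=> n; apply: emeasurable_funM => //; exact/measurable_EFinP.
- by move=> nu _; apply: cvgeZr => //; exact: tL.
- by [].
- exact: finite_measure_integrable_cst.
- move=> n nu _; have /andP[w0 wM] := w0M nu.
  rewrite gee0_abs ?mule_ge0//.
  rewrite (le_trans (y := 1 * (w nu)%:E))//; last by rewrite mul1e lee_fin.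
  apply: lee_wpmul2r; first by rewrite lee_fin.
  by apply: probability_le1; exact: measurable_tail.
Qed.

(* The survival functions of all the [K nu] are continuous, so bounds on their
   mixture at the points of [E] and of its complement pass to the threshold
   separating them. *)
Lemma mixture_upset_bounds (E : set R) (lo hi : \bar R) :
  measurable E -> upset E ->
  lo <= \int[G]_nu (w nu)%:E -> 0 <= hi ->
  (forall t, E t -> N_ t <= hi) -> (forall t, ~ E t -> lo <= N_ t) ->
  lo <= \int[G]_nu (K nu E * (w nu)%:E) <= hi.
Proof.
move=> mE upE lo1 hi0 Ehi Elo.
have [E0|[c [c0 cE Ec]]] := upset_threshold _ _ upE.
  (* Every [n] lies outside [E], and the tails at [n] tend to mass [0]; hence [lo <= 0]. *)
  rewrite integral0_eq; last by move=> nu _; rewrite E0 measure0 mul0e.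
  rewrite hi0 andbT.
  have h : (fun n => N_ n%:R) @ \oo --> \int[G]_nu (0 * (w nu)%:E).
    by apply: N_cvg => nu; exact: tail_cvg_infty.
  have -> : 0 = limn (fun n => N_ n%:R).
    by rewrite (cvg_lim _ h)// integral0_eq// => nu _; rewrite mul0e.
  apply: lime_ge; first by apply/cvg_ex; eexists; exact: h.
  by apply: nearW => n; apply: Elo; rewrite E0.
apply/andP; split; last first.
  have h : (fun n => N_ (c + n.+1%:R^-1)) @ \oo --> \int[G]_nu (K nu E * (w nu)%:E).
    by apply: N_cvg => nu; exact: tail_cvg_right.
  rewrite -(cvg_lim _ h)//; apply: lime_le; first by apply/cvg_ex; eexists; exact: h.
  apply: nearW => n; apply/Ehi/cE.
  by rewrite ger0_norm ?addr_ge0// ltrDl invr_gt0.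
have [c_gt0|c_le0] := ltP 0%R c; last first.
  (* At threshold [0] no point lies below to approximate from, but [E] has full mass and [lo1] gives
     the bound. *)
  have c00 : c = 0%R by apply/eqP; rewrite eq_le c_le0.
  apply: (le_trans lo1); apply: ge0_le_integral => //.
  - by move=> nu _; rewrite lee_fin; case/andP: (w0M nu).
  - exact/measurable_EFinP.
  - apply: emeasurable_funM; last exact/measurable_EFinP.
    by rewrite (_ : (fun nu => _) = (fun nu => K nu [set x | (`|c| <= `|x|)%R]))//;
      apply/funext => nu; exact: measure_upset.
  - move=> nu _; rewrite (measure_upset _ (acK nu) E c)// c00 normr0.
    rewrite (_ : [set x | _] = setT) ?probability_setT ?mul1e//.
    by apply/seteqP; split => x //= _.
have h : (fun n => N_ (Num.max 0 (c - n.+1%:R^-1))%R) @ \oo -->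
    \int[G]_nu (K nu E * (w nu)%:E).
  by apply: N_cvg => nu; exact: tail_cvg_left.
rewrite -(cvg_lim _ h)//; apply: lime_ge; first by apply/cvg_ex; eexists; exact: h.
apply: nearW => n; apply: Elo => /Ec; apply/negP; rewrite -ltNge.
rewrite ger0_norm ?le_max ?lexx// gt_max c_gt0/= ltrBlDr ltrDl invr_gt0//.
Qed.

End mixture_upset.

(** * Measurability of integrals against probability kernels *)

Section probability_kernels.
Local Open Scope ereal_scope.
Context {R : realType}.

Lemma measurable_pprobability dX (X : measurableType dX) dY (Y : measurableType dY)
    (P : X -> pprobability Y R) :
  (forall A, measurable A -> measurable_fun setT (fun x => (P x : probability Y R) A)) ->
  measurable_fun setT P.
Proof.
move=> mP; apply: (@measurability _ _ X (pprobability Y R) setT P (@pset _ Y R)) => //.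
move=> _ [_ [r _ [A mA <-]] <-]; rewrite setTI.
have := mP A mA measurableT `]-oo, r%:E[%classic (emeasurable_itv _).
rewrite setTI; congr measurable.
Qed.

Lemma measurable_integral_probability dX (X : measurableType dX)
    dY (Y : measurableType dY) (P : X -> probability Y R) (f : X * Y -> \bar R) :
  (forall A, measurable A -> measurable_fun setT (fun x => P x A)) ->
  (forall z, 0 <= f z) -> measurable_fun setT f ->
  measurable_fun setT (fun x => \int[P x]_y f (x, y)).
Proof.
move=> mP f0 mf.
have mP' : measurable_fun setT (P : X -> pprobability Y R).
  exact: measurable_pprobability.
exact: (measurable_fun_integral_finite_kernel f (kprobability mP')).
Qed.

Lemma measurable_section_probability dX (X : measurableType dX)
    dY (Y : measurableType dY) (P : X -> probability Y R) (A : set (X * Y)) :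
  (forall B, measurable B -> measurable_fun setT (fun x => P x B)) ->
  measurable A -> measurable_fun setT (fun x => P x [set y | A (x, y)]).
Proof.
move=> mP mA.
have := measurable_integral_probability _ X _ Y P (fun z => (\1_A z)%:E) mP.
have -> : (fun x => P x [set y | A (x, y)]) = (fun x => \int[P x]_y (\1_A (x, y))%:E).
  apply/funext => x; have <- : xsection A x = [set y | A (x, y)].
    by apply/seteqP; split => y; rewrite /xsection/= inE.
  have mAx := measurable_xsection x mA.
  transitivity (\int[P x]_y (\1_(xsection A x) y)%:E).
    by rewrite integral_indic// setIT.
  apply: eq_integral => y _.
  by congr (_ %:E); rewrite !indicE /xsection; congr (_%:R); rewrite mem_setE.
apply=> [z|]; first by rewrite lee_fin.
exact/measurable_EFinP.
Qed.

End probability_kernels.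

Lemma sigma_finite_measureP dT (T : measurableType dT) (R : realType)
    (m : {measure set T -> \bar R}) : sigma_finite setT m ->
  exists M : {sigma_finite_measure set T -> \bar R}, forall A, M A = m A.
Proof.
case: m => f [h1 h2] sf.
pose m : {measure set T -> \bar R} := HB.pack f h1 h2.
have sfi : sfinite_measure f := @sfinite_measure_sigma_finite _ _ _ m sf.
pose M : {sigma_finite_measure set T -> \bar R} :=
  HB.pack f h1 h2 (@isSFinite.Build _ _ _ f sfi) (isSigmaFinite.Build _ _ _ f sf).
by exists M.
Qed.

Lemma cvge0_lt (R : realType) (u : (\bar R)^nat) (e : R) :
  u @ \oo --> 0%E -> 0 < e -> \forall n \near \oo, (u n < e%:E)%E.
Proof.
move=> u0 e0; apply: (u0 [set x | (x < e%:E)%E]).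
apply: open_nbhs_nbhs; split; first exact: open_ereal_lt_ereal.
by rewrite /= lte_fin.
Qed.

Lemma abse_subC (R : realDomainType) (x y : \bar R) : `|x - y|%E = `|y - x|%E.
Proof. by move: x y => [x| |] [y| |] //=; rewrite distrC. Qed.

(** * Calibration of a null unit given the other units *)

Section calibration.
Local Open Scope ereal_scope.
Context {R : realType} {V : pointedType} (d : V -> V -> R) {U : ptopologicalType}.
Variables (lam : {measure set (Um U) -> \bar R}) (p : Um U -> Vm d -> R).
Variables (Kc : Vm d -> Um U -> probability R R).
Variables (kappa0 : Vm d -> probability (R * Um U)%type R).
Variable Gs : probability (Vm d) R.
Hypothesis md : is_metric d.
Hypothesis cd : dcompact_space d.
Hypothesis mp : measurable_fun setT (fun x : (Um U * Vm d)%type => p x.1 x.2).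
Hypothesis p0 : forall u nu, (0 <= p u nu)%R.
Hypothesis p1 : forall nu, \int[lam]_u (p u nu)%:E = 1.
Hypothesis tight : forall e : R, (0 < e)%R -> exists C : set U, compact C /\
  forall nu : Vm d, lawU lam p nu (~` C) < e%:E.
Hypothesis equip : forall C : set U, compact C -> forall (nu : Vm d) (e : R),
  (0 < e)%R -> exists2 delta : R, (0 < delta)%R &
    forall (u : Um U) (nu' : Vm d), C u -> (d nu nu' < delta)%R ->
      (`|p u nu - p u nu'| < e)%R.
Hypothesis boundp : forall C : set U, compact C ->
  exists M : R, forall (u : Um U) (nu : Vm d), C u -> (p u nu <= M)%R.
Hypothesis mKc : forall nu (A : set R), measurable A ->
  measurable_fun setT (fun u : Um U => Kc nu u A).
Hypothesis acKc : forall nu u, Kc nu u `<< (@lebesgue_measure R).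
Hypothesis equiKc : forall e : R, (0 < e)%R -> exists2 delta : R, (0 < delta)%R &
  forall (t : R) (u : Um U) (nu nu' : Vm d), (d nu nu' < delta)%R ->
    (`|Por Kc t u nu - Por Kc t u nu'| < e)%R.
Hypothesis kappa0E : forall nu (A : set R) (B : set (Um U)),
  measurable A -> measurable B ->
  kappa0 nu (A `*` B) = \int[lam]_(u in B) (Kc nu u A * (p u nu)%:E).

Lemma density_measurable1 nu : measurable_fun setT (fun u => (p u nu)%:E).
Proof. by apply/measurable_EFinP; exact: (measurable_fun_pair1 nu mp). Qed.

Lemma density_measurable2 u : measurable_fun setT (fun nu => (p u nu)%:E).
Proof. by apply/measurable_EFinP; exact: (measurable_fun_pair2 u mp). Qed.

(* [C] need not be measurable: the integral defining [lawU] is then a lower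
   integral, and bounds every measurable function vanishing on [C]. *)
Lemma integral_le_lawUC (C : set U) nu (g : Um U -> \bar R) :
  (forall u, 0 <= g u) -> (forall u, g u <= (p u nu)%:E) ->
  (forall u, C u -> g u = 0) -> \int[lam]_u g u <= lawU lam p nu (~` C).
Proof.
move=> g0 gp gC; rewrite /lawU [leRHS]integral_mkcond; apply: nonneg_le_integral => // u.
rewrite patchE; case: ifPn => [_|]; first exact: gp.
by rewrite notin_setE /= => /contrapT /gC ->.
Qed.

Lemma dense_seq : exists x : nat -> V, forall y (e : R), (0 < e)%R ->
  exists n, (d y (x n) < e)%R.
Proof.
have sym : forall x y, d x y = d y x by case: md.
have k0 (k : nat) : (0 < k.+1%:R^-1 :> R)%R by rewrite invr_gt0.
have /choice[s hs] (k : nat) := finite_net d md cd (fun _ => (k.+1%:R^-1 : R)%R) (fun _ => k0 k).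
pose x n := if unpickle n is Some (k, j) then nth point (s k) j else point.
exists x => y e e0.
have [k _ /(_ k (leqnn k)) /= ke] := near_infty_natSinv_lt (PosNum e0).
have [z zs zy] := hs k y.
exists (pickle (k, index (z : {classic V}) (s k))).
rewrite /x pickleK (_ : nth _ _ _ = z); first by rewrite sym (lt_trans zy).
exact: (@nth_index {classic V}).
Qed.

(* [lamW] is [lam] restricted to the set where some [p _ (x n)] is positive, for
   [x] dense: it carries all the laws of [U], because [p u] is continuous for [u]
   in a compact set. *)
Lemma sigma_finite_dominating : exists lamW : {sigma_finite_measure set (Um U) -> \bar R},
  forall nu (g : Um U -> \bar R), measurable_fun setT g ->
    (forall u, 0 <= g u) -> (forall u, g u <= (p u nu)%:E) ->
    \int[lam]_u g u = \int[lamW]_u g u.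
Proof.
have [x hx] := dense_seq.
pose W := \bigcup_n [set u : Um U | (0 < p u (x n))%R].
have mlt (r : R) nu : measurable [set u : Um U | (r < p u nu)%R].
  have /measurable_EFinP := density_measurable1 nu.
  move=> /(_ measurableT `]r, +oo[%classic (measurable_itv _)).
  rewrite setTI; congr measurable.
  by apply/seteqP; split => u /=; rewrite in_itv/= andbT.
have mW : measurable W by apply: bigcup_measurable => n _; exact: mlt.
have mindW : measurable_fun setT (fun u : Um U => (\1_W u)%:E : \bar R).
  exact/measurable_EFinP.
have mdir A : measurable A -> measurable_fun setT
    (fun u : Um U => (dirac u : {measure set (Um U) -> \bar R}) A).
  by move=> mA; apply/measurable_EFinP; exact: measurable_indic.
have ind0 u : 0 <= (\1_W u)%:E :> \bar R by rewrite lee_fin.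
have [m [mE mI]] := mixture_measure _ _ _ _ R lam _
  (fun u => dirac u : {measure set (Um U) -> \bar R}) ind0 mindW mdir.
have mI' g : measurable_fun setT g -> (forall u, 0 <= g u) ->
    \int[m]_u g u = \int[lam]_u ((\1_W u)%:E * g u).
  move=> mg g0; rewrite mI//; apply: eq_integral => u _.
  by rewrite integral_dirac// diracT mul1e.
have sfm : sigma_finite setT m.
  (* By Markov's inequality and [p1], [p _ (x j)] exceeds [k.+1%:R^-1] on a set of mass at most
     [k.+1], and these sets cover [W]. Index [0] and the numbers that encode no pair receive the
     complement of [W], which is null. *)
  pose F n := if unpickle n is Some (k, j) then
    ([set u : Um U | k.+1%:R^-1 < p u (x j)]%R) else ~` W.
  have m0 : m (~` W) = 0.
    rewrite mE integral0_eq// => u _; rewrite /= /dirac !indicE in_setC.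
    by case: (u \in W); rewrite ?mule0 ?mul0e.
  exists (fun n => if n is n'.+1 then F n' else ~` W).
    apply/seteqP; split => // u _.
    have [[j _ /= uj]|nW] := pselect (W u); last by exists 0%N.
    have [k _ /(_ k (leqnn k)) /= ke] := near_infty_natSinv_lt (PosNum uj).
    by exists (pickle (k, j)).+1 => //; rewrite /F pickleK.
  case=> [|n]; first by split; [exact: measurableC|rewrite m0].
  rewrite /F; case: (unpickle n) => [[k j]|]; last first.
    by split; [exact: measurableC|rewrite m0].
  split; first exact: mlt.
  set A := [set u | _]; have mA : measurable A by exact: mlt.
  have -> : m A = \int[m]_u (\1_A u)%:E by rewrite integral_indic// setIT.
  rewrite mI'; [|exact/measurable_EFinP|by move=> u; rewrite lee_fin].
  apply: (@le_lt_trans _ _ (\int[lam]_u (k.+1%:R%:E * (p u (x j))%:E))).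
    apply: nonneg_le_integral => u; first by rewrite mule_ge0// lee_fin.
    rewrite -!EFinM lee_fin !indicE.
    have k1 : (0 < k.+1%:R :> R)%R by rewrite ltr0n.
    case: (boolP (u \in A)) => uA; last by rewrite mulr0 mulr_ge0// ltW.
    rewrite mulr1 (@le_trans _ _ 1%R)//; first by case: (u \in W).
    by rewrite -ler_pdivrMl// mulr1 ltW//; move: uA; rewrite inE.
  rewrite ge0_integralZl_EFin//;
    [|by move=> u _; rewrite lee_fin|exact: density_measurable1].
  by rewrite p1 mule1 ltry.
have [M ME] := sigma_finite_measureP _ _ _ _ sfm.
exists M => nu g mg g0 gp.
have -> : \int[M]_u g u = \int[lam]_u ((\1_W u)%:E * g u)
  by rewrite -mI'//; apply: eq_measure_integral => A _ _; exact: ME.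
have mindWc : measurable_fun setT (fun u : Um U => (\1_(~` W) u)%:E : \bar R).
  by apply/measurable_EFinP; apply: measurable_indic; exact: measurableC.
have indc0 u : 0 <= (\1_(~` W) u)%:E :> \bar R by rewrite lee_fin.
have gE u : g u = (\1_W u)%:E * g u + (\1_(~` W) u)%:E * g u.
  rewrite !indicE in_setC; case: (u \in W) => /=.
    by rewrite mul1e mul0e adde0.
  by rewrite mul1e mul0e add0e.
under eq_integral do rewrite gE.
rewrite ge0_integralD//;
  [|by move=> u _; rewrite mule_ge0|exact: emeasurable_funM
   |by move=> u _; rewrite mule_ge0|exact: emeasurable_funM].
rewrite [X in _ + X](_ : _ = 0) ?adde0//.
apply/eqP; rewrite eq_le; apply/andP; split; last first.
  by apply: integral_ge0 => u _; rewrite mule_ge0.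
(* Off [W], [g] vanishes on the compact set [C]: if [p u nu] were positive, equicontinuity on [C]
   would make some [p u (x n)] positive. What remains is at most the mass outside [C]. *)
apply/lee_addgt0Pr => e e0; rewrite add0e.
have [C [cC hC]] := tight _ e0.
apply: le_trans (ltW (hC nu)).
apply: integral_le_lawUC => [u|u|u Cu].
- by rewrite mule_ge0.
- rewrite indicE; case: (u \in _); first by rewrite mul1e.
  by rewrite mul0e lee_fin.
- rewrite indicE in_setC; case: (boolP (u \in W)) => uW; first by rewrite mul0e.
  rewrite mul1e; apply/eqP; rewrite eq_le g0 andbT (le_trans (gp u))// lee_fin.
  rewrite leNgt; apply/negP => pu; move: uW; rewrite notin_setE; apply.
  have [dl dl0 h] := equip _ cC nu _ pu.
  have [n xn] := hx nu _ dl0; have := h u _ Cu xn.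
  rewrite ltr_distlC subrr => /andP[pn _].
  by exists n.
Qed.

Lemma PorE t u nu : (Por Kc t u nu)%:E = Kc nu u [set x | (`|t| <= `|x|)%R].
Proof. by rewrite /Por fineK// fin_num_measure//; exact: measurable_tail. Qed.

Lemma Por_ge0 t u nu : (0 <= Por Kc t u nu)%R.
Proof. by rewrite -lee_fin PorE. Qed.

Lemma Por_le1 t u nu : (Por Kc t u nu <= 1)%R.
Proof. by rewrite -lee_fin PorE; apply: probability_le1; exact: measurable_tail. Qed.

Lemma Por0 u nu : Por Kc 0 u nu = 1%R.
Proof.
apply: EFin_inj; rewrite PorE (_ : [set x | _] = setT) ?probability_setT//.
by apply/seteqP; split => x //= _; rewrite normr0.
Qed.

(** [Kc] is assumed measurable in [u] only. Measurability in [(t, u)] comes from sections of a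
    measurable set, joint measurability with [nu] from equicontinuity. *)
Lemma measurable_Por :
  measurable_fun setT (fun z : ((R * Um U) * Vm d)%type => Por Kc z.1.1 z.1.2 z.2).
Proof.
apply: (equicontinuous_measurable d md cd _ _ (fun tu nu => Por Kc tu.1 tu.2 nu)).
  move=> nu; apply: measurableT_comp => //.
  pose A := [set z : ((R * Um U) * R)%type | (`|z.1.1| <= `|z.2|)%R].
  apply: (measurable_section_probability _ (R * Um U)%type _ R
    (fun tu => Kc nu tu.2) A).
    by move=> B mB; apply: (measurableT_comp (mKc nu B mB)).
  have mf : measurable_fun setT
      (fun z : ((R * Um U) * R)%type => (`|z.1.1| <= `|z.2|)%R).
    apply: measurable_fun_ler; apply: measurableT_comp => //.
    exact: measurableT_comp.
  have -> : A = setT `&` (fun z : ((R * Um U) * R)%type =>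
      (`|z.1.1| <= `|z.2|)%R) @^-1` [set true] by rewrite setTI; apply/seteqP; split.
  exact: mf.
move=> e e0; have [dl dl0 h] := equiKc e e0; exists dl => // tu nu nu'.
exact: h.
Qed.

Lemma measurable_Por_density u t : measurable_fun setT
  (fun nu => Por Kc t u nu * p u nu)%R.
Proof.
apply: measurable_funM; last exact: (measurable_fun_pair2 u mp).
exact: (measurable_fun_pair2 (t, u) measurable_Por).
Qed.

(** A rejection region is not a rectangle, hence this extension: both sides are finite measures in
    [E] that agree on the pi-system of rectangles. *)
Lemma disintegration nu (E : set (R * Um U)) : measurable E ->
  kappa0 nu E = \int[lam]_u (Kc nu u [set t | E (t, u)] * (p u nu)%:E).
Proof.
move=> mE.
have mpair u : measurable_fun setT (fun t : R => (t, u) : (R * Um U)%type).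
  exact: measurable_fun_pair.
pose k u : {measure set (R * Um U)%type -> \bar R} :=
  @measure_function_pushforward__canonical__measure_function_Measure _ _ _ _ R
    (Kc nu u) (fun t : R => (t, u)) (mpair u).
have p0' u : 0 <= (p u nu)%:E by rewrite lee_fin.
have mk A : measurable A -> measurable_fun setT (k ^~ A).
  move=> mA; rewrite /k /=.
  apply: (measurable_section_probability _ (Um U) _ R (fun u => Kc nu u)
    [set z | A (z.2, z.1)]); first exact: mKc.
  have : measurable_fun setT (fun z : (Um U * R)%type => (z.2, z.1)).
    exact: measurable_fun_pair.
  by move=> /(_ measurableT A mA); rewrite setTI.
have [m [mE' _]] := mixture_measure _ _ _ _ R lam _ k p0'
  (density_measurable1 nu) mk.
pose G := [set A `*` B | A in (measurable : set (set R)) &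
                         B in (measurable : set (set (Um U)))].
transitivity (m E); last first.
  by rewrite mE'; apply: eq_integral => u _; rewrite muleC.
apply: (measure_unique G (fun=> setT)) => //.
- exact: measurable_prod_measurableType.
- move=> _ _ [A1 mA1 [B1 mB1 <-]] [A2 mA2 [B2 mB2 <-]].
  exists (A1 `&` A2); first exact: measurableI.
  by exists (B1 `&` B2); [exact: measurableI|rewrite setXI].
- by move=> _; exists setT => //; exists setT => //; rewrite setXTT.
- by rewrite bigcup_const.
- move=> _ [A mA [B mB <-]]; rewrite [LHS]kappa0E// [LHS]integral_mkcond mE'.
  apply: eq_integral => u _; rewrite patchE /k /= /pushforward.
  case: ifPn => uB.
    rewrite muleC; congr (_ * Kc nu u _).
    by apply/seteqP; split => t //=; [move=> ?; split => //; exact: set_mem|case].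
  rewrite (_ : _ @^-1` _ = set0) ?measure0 ?mule0//.
  apply/seteqP; split => // t [_ /=] uB'; move: uB.
  by rewrite (mem_set uB').
- move=> _; apply: le_lt_trans (ltry 1).
  by apply: probability_le1.
Qed.

(** Each section is empty or has the mass of a tail. The modulus in [equiKc] is uniform in [t], so
    it does not matter how the threshold depends on [u]. *)
Lemma measurable_upset_sections (E : set (R * Um U)) : measurable E ->
  (forall u, upset [set t | E (t, u)]) ->
  measurable_fun setT (fun z : (Um U * Vm d)%type => Kc z.2 z.1 [set t | E (t, z.1)]).
Proof.
move=> mE upE.
have mEu u : measurable [set t | E (t, u)].
  have : measurable_fun setT (fun t : R => (t, u) : (R * Um U)%type).
    exact: measurable_fun_pair.
  by move=> /(_ measurableT E mE); rewrite setTI.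
have EF (z : (Um U * Vm d)%type) : Kc z.2 z.1 [set t | E (t, z.1)] =
    (fine (Kc z.2 z.1 [set t | E (t, z.1)]))%:E.
  by rewrite fineK// fin_num_measure.
rewrite (funext EF); apply/measurable_EFinP.
apply: (equicontinuous_measurable d md cd _ _
  (fun u nu => fine (Kc nu u [set t | E (t, u)]))).
  move=> nu; apply: measurableT_comp => //.
  apply: (measurable_section_probability _ (Um U) _ R (fun u => Kc nu u)
    [set z | E (z.2, z.1)]) => //; first exact: mKc.
  have : measurable_fun setT (fun z : (Um U * R)%type => (z.2, z.1)).
    exact: measurable_fun_pair.
  by move=> /(_ measurableT E mE); rewrite setTI.
move=> e e0; have [dl dl0 h] := equiKc e e0; exists dl => // u nu nu' nn'.
have [E0|[c [c0 cE Ec]]] := upset_threshold _ _ (upE u).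
  by rewrite E0 !measure0 subrr normr0.
have mup nu1 : Kc nu1 u [set t | E (t, u)] = Kc nu1 u [set x | (`|c| <= `|x|)%R].
  exact: measure_upset.
by rewrite !mup; exact: h.
Qed.

Definition pval_mix (m : set (Vm d) -> \bar R) (t : R) (u : Um U) : R :=
  fine (\int[m]_nu (Por Kc t u nu * p u nu)%:E) / fine (\int[m]_nu (p u nu)%:E).

Lemma Por_density_ge0 t u nu : (0 <= Por Kc t u nu * p u nu)%R.
Proof. by rewrite mulr_ge0// Por_ge0. Qed.

Lemma Por_density_le t u nu : (Por Kc t u nu * p u nu <= p u nu)%R.
Proof. by rewrite ler_piMl// Por_le1. Qed.

Lemma pval_mix_upset (m : {measure set (Vm d) -> \bar R}) a u :
  upset [set t | (pval_mix m t u <= a)%R].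
Proof.
move=> x y /= xa xy; apply: le_trans xa; rewrite /pval_mix.
have int_ge0 (f : Vm d -> R) : (forall nu, 0 <= f nu)%R -> 0 <= \int[m]_nu (f nu)%:E.
  by move=> f0; apply: integral_ge0 => nu _; rewrite lee_fin.
(* When the denominator is [+oo], [fine] and [invr0] make the p-value [0] for every [t]. *)
have [pfin|] := ltP (\int[m]_nu (p u nu)%:E) +oo; last first.
  by rewrite leye_eq => /eqP ->; rewrite /= invr0 !mulr0.
rewrite ler_wpM2r ?invr_ge0 ?fine_ge0 ?int_ge0//.
have Pfin t : \int[m]_nu (Por Kc t u nu * p u nu)%:E \is a fin_num.
  rewrite ge0_fin_numE ?int_ge0//; last by move=> nu; exact: Por_density_ge0.
  apply: le_lt_trans pfin; apply: nonneg_le_integral => nu; rewrite lee_fin.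
    exact: Por_density_ge0.
  exact: Por_density_le.
rewrite fine_le//; apply: nonneg_le_integral => nu; rewrite lee_fin.
  exact: Por_density_ge0.
rewrite ler_wpM2r// -lee_fin !PorE; apply: le_measure; rewrite ?inE;
  [exact: measurable_tail|exact: measurable_tail|].
by move=> z /=; exact: le_trans.
Qed.

Lemma integral_bounded_fin (m : {measure set (Vm d) -> \bar R}) (f : Vm d -> R) M :
  m setT = 1 -> measurable_fun setT f -> (forall nu, 0 <= f nu <= M)%R ->
  \int[m]_nu (f nu)%:E \is a fin_num.
Proof.
move=> m1 mf fM.
rewrite ge0_fin_numE; last by apply: integral_ge0 => nu _; rewrite lee_fin; case/andP: (fM nu).
apply: (@le_lt_trans _ _ (\int[m]_nu (cst M%:E) nu)).
  apply: nonneg_le_integral => nu; rewrite lee_fin; by case/andP: (fM nu).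
by rewrite integral_cst// [X in _ * X]m1 mule1 ltry.
Qed.

(** With [nm t] and [n t] the numerators under [m] and [Gs], the denominators are [nm 0] and [n 0].
    Clearing them, [nm t <= a * nm 0] gives [n t <= a * n 0 + 2 * xi], one [xi] for each replacement
    of [m] by [Gs]; the complement is symmetric. *)
Lemma section_bounds (m : {measure set (Vm d) -> \bar R}) (u : Um U) (M xi a : R) :
  m setT = 1 -> (forall nu, p u nu <= M)%R -> (0 <= xi)%R -> (0 <= a <= 1)%R ->
  (forall t, \int[m]_nu (Por Kc t u nu * p u nu)%:E <=
     \int[Gs]_nu (Por Kc t u nu * p u nu)%:E + xi%:E) ->
  (forall t, \int[Gs]_nu (Por Kc t u nu * p u nu)%:E <=
     \int[m]_nu (Por Kc t u nu * p u nu)%:E + xi%:E) ->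
  measurable [set t | (pval_mix m t u <= a)%R] ->
  a%:E * \int[Gs]_nu (p u nu)%:E - (2 * xi)%:E <=
  \int[Gs]_nu (Kc nu u [set t | (pval_mix m t u <= a)%R] * (p u nu)%:E) <=
  a%:E * \int[Gs]_nu (p u nu)%:E + (2 * xi)%:E.
Proof.
move=> m1 pM xi0 /andP[a0 a1] h1 h2 mE.
have PorM t nu : (0 <= Por Kc t u nu * p u nu <= M)%R.
  by rewrite Por_density_ge0 (le_trans (Por_density_le t u nu)).
have mPor t := measurable_Por_density u t.
have finm t := integral_bounded_fin m _ M m1 (mPor t) (PorM t).
have finG t := integral_bounded_fin Gs _ M (probability_setT Gs) (mPor t) (PorM t).
pose nm t := fine (\int[m]_nu (Por Kc t u nu * p u nu)%:E).
pose n t := fine (\int[Gs]_nu (Por Kc t u nu * p u nu)%:E).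
have nmE t : \int[m]_nu (Por Kc t u nu * p u nu)%:E = (nm t)%:E by rewrite fineK.
have nE t : \int[Gs]_nu (Por Kc t u nu * p u nu)%:E = (n t)%:E by rewrite fineK.
have pmE : \int[m]_nu (p u nu)%:E = (nm 0%R)%:E.
  by rewrite -nmE; apply: eq_integral => nu _; rewrite Por0 mul1r.
have pGE : \int[Gs]_nu (p u nu)%:E = (n 0%R)%:E.
  by rewrite -nE; apply: eq_integral => nu _; rewrite Por0 mul1r.
have {}h1 t : (nm t <= n t + xi)%R by have := h1 t; rewrite nmE nE -EFinD lee_fin.
have {}h2 t : (n t <= nm t + xi)%R by have := h2 t; rewrite nmE nE -EFinD lee_fin.
have n0 t : (0 <= n t)%R.
  by rewrite fine_ge0//; apply: integral_ge0 => nu _; rewrite lee_fin Por_density_ge0.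
have nm0 t : (0 <= nm t)%R.
  by rewrite fine_ge0//; apply: integral_ge0 => nu _; rewrite lee_fin Por_density_ge0.
have nm_le t : (nm t <= nm 0)%R.
  rewrite -lee_fin -!nmE; apply: nonneg_le_integral => nu; rewrite lee_fin.
    exact: Por_density_ge0.
  by rewrite Por0 mul1r Por_density_le.
have pvE t : pval_mix m t u = (nm t / nm 0)%R by rewrite /pval_mix nmE pmE.
have NE t : \int[Gs]_nu (Kc nu u [set x | (`|t| <= `|x|)%R] * (p u nu)%:E) = (n t)%:E.
  by rewrite -nE; apply: eq_integral => nu _; rewrite -PorE -EFinM.
have axi : (a * xi <= xi)%R by rewrite ler_piMl.
have ah1 : (a * nm 0 <= a * n 0 + a * xi)%R by rewrite -mulrDr ler_wpM2l.
have ah2 : (a * n 0 <= a * nm 0 + a * xi)%R by rewrite -mulrDr ler_wpM2l.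
have an0 : (0 <= a * n 0)%R by rewrite mulr_ge0.
have an1 : (a * n 0 <= n 0)%R by rewrite ler_piMl.
rewrite pGE -EFinM -EFinB -EFinD.
apply: (mixture_upset_bounds _ _ Gs (fun nu => Kc nu u) (p u) M) => //.
- move=> t; under eq_fun do rewrite -PorE; apply/measurable_EFinP.
  exact: (measurable_fun_pair2 (t, u) measurable_Por).
- exact: (measurable_fun_pair2 u mp).
- by move=> nu; rewrite p0 pM.
- exact: pval_mix_upset.
- by rewrite pGE lee_fin; lra.
- by rewrite lee_fin; lra.
- move=> t; rewrite NE /= lee_fin pvE.
  (* A zero denominator makes the p-value [0], so every [t] is rejected; [nm t] vanishes too, whence
     [n t <= xi]. *)
  have [nm00|nm00] := leP (nm 0%R) 0%R.
    by move=> _; have := h2 t; have := nm_le t; lra.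
  by rewrite ler_pdivrMr// => ht; have := h2 t; lra.
- move=> t; rewrite NE /= lee_fin pvE => /negP; rewrite -ltNge.
  have [nm00|nm00] := leP (nm 0%R) 0%R.
    have -> : nm 0%R = 0%R by apply/eqP; rewrite eq_le nm00 nm0.
    by rewrite invr0 mulr0 ltNge a0.
  by rewrite ltr_pdivlMr// => ht; have := h1 t; lra.
Qed.

Lemma Por_density_equicontinuous (C : set U) : compact C ->
  forall e : R, (0 < e)%R -> exists2 delta : R, (0 < delta)%R &
    forall t (u : Um U) nu nu', C u -> (d nu nu' < delta)%R ->
      (`|Por Kc t u nu * p u nu - Por Kc t u nu' * p u nu'| <= e)%R.
Proof.
move=> cC e e0.
have [M0 hM0] := boundp _ cC; pose M := (`|M0| + 1)%R.
have M_gt0 : (0 < M)%R by rewrite ltr_wpDl.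
have pM u nu : C u -> (p u nu <= M)%R.
  by move=> Cu; rewrite (le_trans (hM0 u nu Cu))// (le_trans (ler_norm _))// lerDl.
have e20 : (0 < e / 2)%R by rewrite divr_gt0.
have eM0 : (0 < e / 2 / M)%R by rewrite divr_gt0.
have equip' : forall nu e1, (0 < e1)%R -> exists2 delta : R, (0 < delta)%R &
    forall (u : Um U) nu', (C : set (Um U)) u -> (d nu nu' < delta)%R ->
    (`|p u nu - p u nu'| < e1)%R.
  exact: equip _ cC.
have [dl1 dl10 hdl1] := equicontinuous_uniform d md cd _ _ _ equip' _ e20.
have [dl2 dl20 hdl2] := equiKc _ eM0.
exists (Num.min dl1 dl2); first by rewrite lt_min dl10.
move=> t u nu nu' Cu; rewrite lt_min => /andP[/(hdl1 u _ _ Cu) q1 /(hdl2 t u) q2].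
have -> : (Por Kc t u nu * p u nu - Por Kc t u nu' * p u nu' =
  Por Kc t u nu * (p u nu - p u nu') + (Por Kc t u nu - Por Kc t u nu') * p u nu')%R.
  by ring.
rewrite (le_trans (ler_normD _ _))// (splitr e) lerD// normrM.
  rewrite (ger0_norm (Por_ge0 _ _ _)) (le_trans _ (ltW q1))//.
  by rewrite ler_piMl// Por_le1.
rewrite (ger0_norm (p0 _ _)) -(divfK (lt0r_neq0 M_gt0) (e / 2)%R).
by rewrite ler_pM// ?pM// ltW.
Qed.

Lemma measurable_margU : measurable_fun setT (margU p Gs).
Proof.
apply: (measurable_fun_fubini_tonelli_F
  (fun z : (Um U * Vm d)%type => (p z.1 z.2)%:E)).
  exact/measurable_EFinP.
by move=> z; rewrite lee_fin.
Qed.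

Lemma margU_ge0 u : 0 <= margU p Gs u.
Proof. by apply: integral_ge0 => nu _; rewrite lee_fin. Qed.

(** A pointwise error of at most [xi] need not have a small integral, since [lamW] may have infinite
    mass. Capped by an integrable [f] it does, by dominated convergence. *)
Lemma integral_min_small (lamW : {measure set (Um U) -> \bar R}) (f : Um U -> \bar R) :
  measurable_fun setT f -> (forall u, 0 <= f u) -> \int[lamW]_u f u < +oo ->
  forall e : R, (0 < e)%R -> exists2 xi : R, (0 < xi)%R &
    \int[lamW]_u mine xi%:E (f u) <= e%:E.
Proof.
move=> mf f0 intf e e0.
have h_ge0 n : (0 < n.+1%:R^-1 :> R)%R by rewrite invr_gt0.
have m0 n u : 0 <= mine (n.+1%:R^-1 : R)%:E (f u).
  by rewrite le_min f0 andbT lee_fin ltW.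
have cvg0 : (fun n => \int[lamW]_u mine (n.+1%:R^-1 : R)%:E (f u)) @ \oo --> (0 : \bar R).
  have -> : 0 = \int[lamW]_u (cst 0 u : \bar R) by rewrite integral0.
  have [] // := @dominated_convergence _ _ _ lamW setT measurableT
    (fun n u => mine (n.+1%:R^-1 : R)%:E (f u)) (cst 0) f.
  - by move=> n; exact: measurable_mine.
  - apply: aeW => u _.
    apply: (@squeeze_cvge _ _ _ _ (cst 0) _ (fun n => (n.+1%:R^-1 : R)%:E)).
    + by apply: nearW => n; rewrite m0 /= ge_min lexx.
    + exact: cvg_cst.
    + exact: cvge_harmonic.
  - apply/integrableP; split => //.
    by under eq_integral do rewrite gee0_abs//.
  - by apply: aeW => u n _; rewrite gee0_abs// ge_min lexx orbT.
have [n _ /(_ n (leqnn n)) hn] := cvge0_lt _ _ _ cvg0 e0.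
by exists (n.+1%:R^-1)%R; [exact: h_ge0|exact: ltW].
Qed.

(** [dl] is chosen before [m] and [a], which yields uniformity in the level, the unit and the data
    of the others. [dl < 1] serves to exclude the degenerate evidence of [posterior_cases]. *)
Lemma calibration_close (e : R) : (0 < e)%R -> exists2 dl : R, (0 < dl < 1)%R &
  forall m : {measure set (Vm d) -> \bar R}, m setT = 1 ->
  (forall psi, BL1 d psi ->
    `|\int[m]_nu (psi nu)%:E - \int[Gs]_nu (psi nu)%:E| <= dl%:E) ->
  forall a : R, (0 <= a <= 1)%R ->
  let E := [set z | (pval_mix m z.1 z.2 <= a)%R] in measurable E ->
  \int[Gs]_nu kappa0 nu E <= a%:E + e%:E /\
  a%:E <= \int[Gs]_nu kappa0 nu E + e%:E.
Proof.
move=> e0; have e20 : (0 < e / 2)%R by rewrite divr_gt0.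
have [C [cC hC]] := tight _ e20.
have [M hM] := boundp _ cC.
have [lamW lamWE] := sigma_finite_dominating.
set fs := margU p Gs.
have mfs : measurable_fun setT fs := measurable_margU.
have fs0 : forall u, 0 <= fs u := margU_ge0.
(* Fubini uses the sigma-finite [lamW]; the inner integral returns to [lam] because [g] is dominated
   by the density. *)
have swap (g : (Um U * Vm d)%type -> \bar R) : measurable_fun setT g ->
    (forall z, 0 <= g z) -> (forall z, g z <= (p z.1 z.2)%:E) ->
    \int[lamW]_u \int[Gs]_nu g (u, nu) = \int[Gs]_nu \int[lam]_u g (u, nu).
  move=> mg g0 gp; rewrite (fubini_tonelli g)//; apply: eq_integral => nu _.
  rewrite -(lamWE nu (fun u => g (u, nu)))//.
  exact: (measurable_fun_pair1 nu mg).
have mpE : measurable_fun setT (fun z : (Um U * Vm d)%type => (p z.1 z.2)%:E).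
  exact/measurable_EFinP.
have ifs : \int[lamW]_u fs u = 1.
  rewrite [LHS](swap (fun z => (p z.1 z.2)%:E))//; last by move=> z; rewrite lee_fin.
  under eq_integral do rewrite /= p1.
  by rewrite integral_cst// mul1e; exact: probability_setT.
have off (A : set (Um U)) : measurable A -> A `&` C = set0 ->
    \int[lamW]_u (fs u * (\1_A u)%:E) <= (e / 2)%:E.
  move=> mA AC.
  have indA0 u : 0 <= (\1_A u)%:E :> \bar R by rewrite lee_fin.
  have -> : \int[lamW]_u (fs u * (\1_A u)%:E) =
      \int[lamW]_u \int[Gs]_nu ((\1_A u)%:E * (p u nu)%:E).
    apply: eq_integral => u _; rewrite muleC ge0_integralZl//.
    - exact: density_measurable2.
    - by move=> nu _; rewrite lee_fin.
  rewrite (swap (fun z => (\1_A z.1)%:E * (p z.1 z.2)%:E)).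
  - apply: (@le_trans _ _ (\int[Gs]_nu (cst (e / 2)%:E) nu)).
      apply: nonneg_le_integral => nu.
        by apply: integral_ge0 => u _; rewrite mule_ge0// lee_fin.
      apply: le_trans (ltW (hC nu)); apply: integral_le_lawUC => //= u.
      + by rewrite mule_ge0// lee_fin.
      + by rewrite -EFinM lee_fin ler_piMl// indicE; case: (_ \in _).
      + move=> Cu; rewrite indicE (_ : u \in A = false) ?mul0e//.
        apply/negbTE/negP; rewrite inE => Au.
        by have : (A `&` C) u by []; rewrite AC.
    by rewrite integral_cst// [X in _ * X]probability_setT mule1.
  - apply: emeasurable_funM => //; apply/measurable_EFinP.
    by apply: measurableT_comp measurable_fst; exact: measurable_indic.
  - by move=> z; rewrite mule_ge0// lee_fin.
  - by move=> z; rewrite -EFinM lee_fin ler_piMl// indicE; case: (_ \in _).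
have [eta eta0 heta] : exists2 xi : R, (0 < xi)%R &
    \int[lamW]_u mine xi%:E (fs u) <= (e / 2)%:E.
  by apply: integral_min_small => //; rewrite ifs ltry.
(* [section_bounds] loses [2 * xi], which must equal [eta]. Each [xi] is shared between the
   equicontinuity error [xi / 2] and the bounded Lipschitz error [K * dl]; [K] dominates [|M|] and
   [|M| / dt], as [integral_le_BL1] demands. *)
pose xi := (eta / 2)%R.
have xi0 : (0 < xi)%R by rewrite divr_gt0.
have xiE : (2 * xi = eta)%R by rewrite /xi mulrC divfK.
have xi20 : (0 < xi / 2)%R by rewrite divr_gt0.
have [dt dt0 hdt] := Por_density_equicontinuous C cC _ xi20.
pose K := (`|M| + `|M| / dt + 1)%R.
have K0 : (0 < K)%R by rewrite ltr_wpDl// addr_ge0// divr_ge0// ltW.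
pose dl := Num.min (2^-1)%R (xi / 2 / K)%R.
have dlK : (K * dl + xi / 2 <= xi)%R.
  rewrite [leRHS]splitr lerD2r mulrC -ler_pdivlMr//.
  by rewrite ge_min lexx orbT.
exists dl.
  rewrite lt_min invr_gt0 ltr0n divr_gt0//= gt_min.
  by rewrite invf_lt1 ?ltr1n.
move=> m m1 mGs a a01 E mE.
have /andP[a0 a1] := a01.
have mEu u : measurable [set t | E (t, u)].
  have : measurable_fun setT (fun t : R => (t, u) : (R * Um U)%type).
    exact: measurable_fun_pair.
  by move=> /(_ measurableT E mE); rewrite setTI.
have upE u : upset [set t | E (t, u)] by exact: pval_mix_upset.
pose H u := \int[Gs]_nu (Kc nu u [set t | E (t, u)] * (p u nu)%:E).
have mKE : measurable_fun setT (fun z : (Um U * Vm d)%type =>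
    Kc z.2 z.1 [set t | E (t, z.1)] * (p z.1 z.2)%:E).
  by apply: emeasurable_funM => //; exact: measurable_upset_sections.
have KE0 (z : (Um U * Vm d)%type) : 0 <= Kc z.2 z.1 [set t | E (t, z.1)] * (p z.1 z.2)%:E.
  by rewrite mule_ge0// lee_fin.
have KEp (z : (Um U * Vm d)%type) :
    Kc z.2 z.1 [set t | E (t, z.1)] * (p z.1 z.2)%:E <= (p z.1 z.2)%:E.
  rewrite -[leRHS]mul1e lee_wpmul2r ?lee_fin//.
  exact: probability_le1.
have mH : measurable_fun setT H.
  exact: (measurable_fun_fubini_tonelli_F (fun z : (Um U * Vm d)%type =>
    Kc z.2 z.1 [set t | E (t, z.1)] * (p z.1 z.2)%:E)).
have H0 u : 0 <= H u by apply: integral_ge0 => nu _; exact: (KE0 (u, nu)).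
have Hfs u : H u <= fs u.
  by apply: nonneg_le_integral => nu; [exact: (KE0 (u, nu))|exact: (KEp (u, nu))].
have PH : \int[Gs]_nu kappa0 nu E = \int[lamW]_u H u.
  rewrite [RHS](swap (fun z => Kc z.2 z.1 [set t | E (t, z.1)] * (p z.1 z.2)%:E))//.
  by apply: eq_integral => nu _; rewrite disintegration.
have bnd u : C u -> a%:E * fs u - eta%:E <= H u <= a%:E * fs u + eta%:E.
  move=> Cu; rewrite -xiE.
  have pM nu : (p u nu <= `|M|)%R by rewrite (le_trans (hM u nu Cu))// ler_norm.
  have PM t nu : (0 <= Por Kc t u nu * p u nu <= `|M|)%R.
    by rewrite Por_density_ge0 (le_trans (Por_density_le t u nu)).
  apply: (section_bounds m u `|M|%R) => //; first exact: ltW.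
  - move=> t; apply: (le_trans (integral_le_BL1 d md m Gs
      (fun nu => Por Kc t u nu * p u nu)%R `|M|%R (xi / 2)%R dt dl K m1
      (probability_setT Gs) (ltW xi20) dt0 (PM t) (fun x y => hdt t u x y Cu)
      (measurable_Por_density u t) K0 _ _ mGs)).
    + by rewrite /K -addrA lerDl addr_ge0// divr_ge0// ltW.
    + by rewrite /K -addrA addrCA lerDl addr_ge0.
    + by rewrite leeD2l// lee_fin.
  - move=> t; apply: (le_trans (integral_le_BL1 d md Gs m
      (fun nu => Por Kc t u nu * p u nu)%R `|M|%R (xi / 2)%R dt dl K
      (probability_setT Gs) m1 (ltW xi20) dt0 (PM t) (fun x y => hdt t u x y Cu)
      (measurable_Por_density u t) K0 _ _ _)).
    + by rewrite /K -addrA lerDl addr_ge0// divr_ge0// ltW.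
    + by rewrite /K -addrA addrCA lerDl addr_ge0.
    + by move=> psi /mGs; rewrite abse_subC.
    + by rewrite leeD2l// lee_fin.
  - exact: (mEu u).
pose b u := mine eta%:E (fs u).
have b0 u : 0 <= b u by rewrite le_min fs0 lee_fin ltW.
have mb : measurable_fun setT b by exact: measurable_mine.
have half : (e / 2)%:E + (e / 2)%:E = e%:E :> \bar R by rewrite -EFinD -splitr.
have afs0 u : 0 <= a%:E * fs u by rewrite mule_ge0.
have afs_le u : a%:E * fs u <= fs u.
  by rewrite -[leRHS]mul1e lee_wpmul2r.
have mafs : measurable_fun setT (fun u => a%:E * fs u) by exact: measurable_funeM.
have iafs : \int[lamW]_u (a%:E * fs u) = a%:E.
  by rewrite ge0_integralZl// ?ifs ?mule1//; exact: fs0.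
(* [C] need not be measurable, so the split of the integral is along the
   measurable set [A] where the pointwise bound fails, which is disjoint from
   [C]. *)
have compare (f g : Um U -> \bar R) : measurable_fun setT f -> measurable_fun setT g ->
    (forall u, 0 <= f u) -> (forall u, 0 <= g u) -> (forall u, f u <= fs u) ->
    (forall u, C u -> f u <= g u + eta%:E) ->
    \int[lamW]_u f u <= \int[lamW]_u g u + e%:E.
  move=> mf mg f0 g0 ffs fgC.
  pose A := [set u | g u + b u < f u].
  have mA : measurable A.
    by rewrite -[A]setTI; apply: measurable_lte => //; exact: emeasurable_funD.
  have AC : A `&` C = set0.
    apply/seteqP; split => // u [Au Cu]; move: Au.
    rewrite /A /= ltNge => /negP; apply.
    rewrite /b /mine; case: ifPn => _; first exact: fgC.
    by rewrite (le_trans (ffs u))// leeDr.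
  have mind : measurable_fun setT (fun u : Um U => (\1_A u)%:E : \bar R).
    exact/measurable_EFinP.
  apply: (@le_trans _ _ (\int[lamW]_u (g u + b u + fs u * (\1_A u)%:E))).
    apply: nonneg_le_integral => // u; rewrite indicE.
    case: (boolP (u \in A)) => uA; first by rewrite mule1 (le_trans (ffs u))// leeDr// adde_ge0.
    rewrite mule0 adde0; move: uA; rewrite notin_setE /A /= => /negP.
    by rewrite -leNgt.
  rewrite ge0_integralD//.
  - rewrite ge0_integralD// -half [leRHS]addeA; apply: leeD; last exact: off.
    by rewrite leeD2l.
  - by move=> u _; rewrite adde_ge0.
  - exact: emeasurable_funD.
  - by move=> u _; rewrite mule_ge0// lee_fin.
  - exact: emeasurable_funM.
(* [compare] is applied to [H] and [a * fs] in both orders, and [a * fs] integrates to [a]. *)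
rewrite PH -[X in _ <= X + _ /\ _]iafs -[X in _ /\ X <= _]iafs; split.
- by apply: compare => // u /bnd /andP[].
- apply: compare => // u /bnd /andP[+ _].
  by rewrite leeBlDr// addeC.
Qed.

End calibration.

(** * Measurability along families of random elements, and insertion into a list *)

Lemma emeasurable_prod dT (T : measurableType dT) (R : realType) (I : Type)
    (r : seq I) (Q : pred I) (f : I -> T -> \bar R) :
  (forall j, measurable_fun setT (f j)) ->
  measurable_fun setT (fun x => \prod_(j <- r | Q j) f j x)%E.
Proof.
move=> mf; elim: r => [|j r IH].
  by under eq_fun do rewrite big_nil; exact: measurable_cst.
under eq_fun do rewrite big_cons.
by case: (Q j) => //; exact: emeasurable_funM.
Qed.

Lemma nth_map_fun (T X : Type) (x0 : X) (ys : seq (T -> X)) j o :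
  nth x0 [seq y o | y <- ys] j = nth (fun=> x0) ys j o.
Proof. by elim: ys j => [|y ys IH] [|j] //=. Qed.

Lemma measurable_nth dT (T : measurableType dT) dX (X : measurableType dX)
    (x0 : X) (ys : seq (T -> X)) j :
  (forall y, List.In y ys -> measurable_fun setT y) ->
  measurable_fun setT (nth (fun=> x0) ys j).
Proof.
elim: ys j => [|y ys IH] [|j] mys /=; [exact: measurable_cst|exact: measurable_cst| |].
  by apply: mys; left.
by apply: IH => z zys; apply: mys; right.
Qed.

Lemma measurable_ev dY (Y : measurableType dY) (R : realType) (A : set Y) :
  measurable A -> measurable_fun setT (fun G : pprobability Y R => (G : probability Y R) A).
Proof.
have h : measurable_fun setT (id : pprobability Y R -> pprobability Y R) by [].
exact: (measurable_kernel (kprobability h)).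
Qed.

Lemma measurable_invr (R : realType) : measurable_fun setT (fun x : R => x^-1).
Proof.
have -> : (fun x : R => x^-1) = (fun x => if x == 0 then 0 else x^-1).
  by apply/funext => x; case: eqP => // ->; rewrite invr0.
apply: measurable_fun_if => //.
- exact: measurable_fun_eqr.
- rewrite setTI (_ : _ @^-1` _ = ~` [set 0]).
    apply: open_continuous_measurable_fun => [|x /[!inE]/= x0].
      by apply: closed_openC; exact: closed_eq.
    by apply: cvgV => //; apply/eqP.
  by apply/seteqP; split => x /=; [move/negbT/eqP|move/eqP/negbTE].
Qed.

Definition insert_at (T : Type) i (x : T) (s : seq T) := take i s ++ x :: drop i s.

Lemma In_map {T1 T2 : Type} {f : T1 -> T2} {s : seq T1} {y} :
  List.In y (map f s) -> exists2 x, List.In x s & y = f x.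
Proof.
elim: s => // x s IH /= [<-|/IH[z zs ->]]; first by exists x => //; left.
by exists z => //; right.
Qed.

Lemma In_insert_at {T : Type} {i} {x y : T} {s : seq T} :
  List.In y (insert_at _ i x s) -> y = x \/ List.In y s.
Proof.
rewrite /insert_at; elim: s i => [|a s IH] [|i] /=; rewrite ?take0 ?drop0 /=.
- by case=> [->|//]; left.
- by case=> [->|//]; left.
- by case=> [->|h]; [left|right].
- by case=> [->|/IH[->|h]]; [right; left|left|right; right].
Qed.

Lemma map_insert_at (T1 T2 : Type) (f : T1 -> T2) i x s :
  map f (insert_at _ i x s) = insert_at _ i (f x) (map f s).
Proof. by rewrite /insert_at map_cat /= map_take map_drop. Qed.

Lemma probabilityP dT (T : measurableType dT) (R : realType)
    (m : {measure set T -> \bar R}) : m setT = 1%E ->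
  exists P : probability T R, forall A, P A = m A.
Proof.
move=> m1.
have E A : @mnormalize _ _ _ m (dirac point) A = m A.
  by rewrite /mnormalize m1 onee_eq0 /= invr1 mule1.
by exists (mnormalize m (dirac point)).
Qed.

(** * The law of a sample as an iterated integral *)

Section data.
Local Open Scope ereal_scope.
Context {R : realType} {V : pointedType} (d : V -> V -> R) {U : ptopologicalType}.
Context {Th : Type} (Gs : probability (Vm d) R).
Variable kappa : Th -> Vm d -> probability (R * Um U)%type R.
Hypothesis mkappa : forall th (A : set (R * Um U)%type), measurable A ->
  measurable_fun setT (fun nu : Vm d => kappa th nu A).

(** With [nu] integrated out each unit has a single law, which turns [dataint] into [iterint]. *)
Lemma unit_law th : exists mu : probability (R * Um U)%type R,
  (forall A, mu A = \int[Gs]_nu kappa th nu A) /\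
  (forall f, (forall x, 0 <= f x) -> measurable_fun setT f ->
    \int[mu]_x f x = \int[Gs]_nu \int[kappa th nu]_x f x).
Proof.
have [m [mE mI]] := mixture_measure _ _ _ (R * Um U)%type R Gs (cst 1)
  (fun nu => kappa th nu : {measure set (R * Um U)%type -> \bar R})
  (fun _ => lee01) (measurable_cst _) (mkappa th).
have m1 : m setT = 1.
  rewrite mE; transitivity (\int[Gs]_nu cst 1 nu).
    by apply: eq_integral => nu _; rewrite mul1e; exact: probability_setT.
  by rewrite integral_cst// mul1e; exact: probability_setT.
have [mu muE] := probabilityP _ _ _ _ m1.
exists mu; split => [A|f f0 mf].
  by rewrite muE mE; apply: eq_integral => nu _; rewrite mul1e.
rewrite (eq_measure_integral m); last by move=> A _ _; exact: muE.
by rewrite mI//; apply: eq_integral => nu _; rewrite mul1e.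
Qed.

(** No measurability is asked of [G], which will be the bounded Lipschitz distance at the posterior
    mean. *)
Lemma le_dataint th j0 k (F G : seq (R * Um U) -> \bar R) :
  (forall s, 0 <= F s) -> (forall s, size s = k -> F s <= G s) ->
  dataint Gs kappa th j0 k F <= dataint Gs kappa th j0 k G.
Proof.
have ge0 j k' F' : (forall s, 0 <= F' s) -> 0 <= dataint Gs kappa th j k' F'.
  elim: k' j F' => [|k' IH] j F' F0 //=.
  by apply: integral_ge0 => nu _; apply: integral_ge0 => x _; exact: IH.
elim: k j0 F G => [|k IH] j0 F G F0 FG /=; first exact: FG.
apply: nonneg_le_integral => nu.
  by apply: integral_ge0 => x _; exact: ge0.
apply: nonneg_le_integral => x; first exact: ge0.
by apply: IH => // s sk; apply: FG; rewrite /= sk.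
Qed.

Lemma dataint_iterint (mu : Th -> probability (R * Um U)%type R) th dO
    (O : measurableType dO) j0 k (F : O -> seq (R * Um U) -> \bar R) o :
  (forall th f, (forall x, 0 <= f x) -> measurable_fun setT f ->
    \int[mu th]_x f x = \int[Gs]_nu \int[kappa th nu]_x f x) ->
  (forall o s, 0 <= F o s) -> mseqfun k F ->
  dataint Gs kappa th j0 k (F o) = iterint [seq mu (th j) | j <- iota j0 k] (F o).
Proof.
move=> muI; elim: k j0 dO O F o => [//|k IH] j0 dO O F o F0 mF /=.
rewrite muI.
- apply: eq_integral => nu _; apply: eq_integral => x _.
  by apply: (IH _ _ _ (fun o s => F o (x :: s))) => //; exact: mseqfun_cons_cst.
- by move=> x; exact: iterint_ge0.
- apply: (iterint_measurable _ _ _ (fun x s => F o (x :: s))) => //.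
  by rewrite size_map size_iota; exact: mseqfun_section.
Qed.

End data.

(** * Posterior mean and partially Bayes p-value *)

Section posterior.
Local Open Scope ereal_scope.
Context {R : realType} {V : pointedType} (d : V -> V -> R) {U : ptopologicalType}.
Variables (p : Um U -> Vm d -> R) (Kc : Vm d -> Um U -> probability R R).
Variable Pi : probability (pprobability (Vm d) R) R.
Variable Gs : probability (Vm d) R.
Hypothesis md : is_metric d.
Hypothesis mp : measurable_fun setT (fun x : (Um U * Vm d)%type => p x.1 x.2).
Hypothesis p0 : forall u nu, (0 <= p u nu)%R.
Hypothesis mPor :
  measurable_fun setT (fun z : ((R * Um U) * Vm d)%type => Por Kc z.1.1 z.1.2 z.2).

Local Notation PV := (pprobability (Vm d) R).

Lemma measurable_mix_ev dO (O : measurableType dO) (f : (O * Vm d)%type -> R) :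
  measurable_fun setT f -> (forall z, 0 <= f z)%R ->
  measurable_fun setT (fun z : (O * PV)%type =>
    \int[(z.2 : probability (Vm d) R)]_nu (f (z.1, nu))%:E).
Proof.
move=> mf f0.
apply: (measurable_integral_probability _ (O * PV)%type _ (Vm d)
  (fun z => (z.2 : probability (Vm d) R))
  (fun z => (f (z.1.1, z.2))%:E)).
- by move=> A mA; exact: (measurableT_comp (measurable_ev _ _ _ A mA)).
- by move=> z; rewrite lee_fin.
- apply/measurable_EFinP.
  have mg : measurable_fun setT (fun z : ((O * PV) * Vm d)%type => (z.1.1, z.2)).
    by apply: measurable_fun_pair => //; exact: measurableT_comp.
  exact: (measurableT_comp mf mg).
Qed.

Lemma measurable_margU_ev dO (O : measurableType dO) (y : O -> Um U) :
  measurable_fun setT y ->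
  measurable_fun setT (fun z : (O * PV)%type => margU p (z.2 : probability (Vm d) R) (y z.1)).
Proof.
move=> my; apply: (measurable_mix_ev _ _ (fun z => p (y z.1) z.2)) => //.
have my' : measurable_fun setT (fun z : (O * Vm d)%type => (y z.1, z.2)).
  by apply: measurable_fun_pair => //; exact: measurableT_comp.
exact: (measurableT_comp mp my').
Qed.

Let margU0 (G : probability (Vm d) R) u : 0 <= margU p G u.
Proof. by apply: integral_ge0 => nu _; rewrite lee_fin. Qed.

Lemma measurable_evid dO (O : measurableType dO) (ys : seq (O -> Um U)) :
  (forall y, List.In y ys -> measurable_fun setT y) ->
  measurable_fun setT (fun o => evid Pi p [seq y o | y <- ys]).
Proof.
move=> mys.
apply: (measurable_fun_fubini_tonelli_F (fun z : (O * PV)%type =>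
   \prod_(u <- [seq y z.1 | y <- ys]) margU p (z.2 : probability (Vm d) R) u)).
  under eq_fun do rewrite big_map.
  elim: ys mys => [|y ys IH] mys.
    by under eq_fun do rewrite big_nil; exact: measurable_cst.
  under eq_fun do rewrite big_cons; apply: emeasurable_funM.
    by apply: measurable_margU_ev; apply: mys; left.
  by apply: IH => z zys; apply: mys; right.
by move=> z; apply: prode_ge0.
Qed.

Lemma measurable_pvalPB dO (O : measurableType dO) i (t : O -> R)
    (ys : seq (O -> Um U)) :
  measurable_fun setT t -> (forall y, List.In y ys -> measurable_fun setT y) ->
  measurable_fun setT (fun o => pvalPB Pi p Kc i (t o) [seq y o | y <- ys]).
Proof.
move=> mt mys; rewrite /pvalPB; apply: measurable_funM; last first.
  apply: measurableT_comp; first exact: measurable_invr.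
  by apply: measurableT_comp => //; exact: measurable_evid.
apply: measurableT_comp => //.
have my j : measurable_fun setT (nth (fun=> (point : Um U)) ys j).
  exact: measurable_nth.
under eq_fun do under eq_integral do
  rewrite -(big_mkord (fun j => j != i) (fun j => margU p _ (nth _ _ j))) size_map nth_map_fun.
apply: (measurable_fun_fubini_tonelli_F (fun z : (O * PV)%type =>
   (\prod_(0 <= j < size ys | j != i)
     margU p (z.2 : probability (Vm d) R) (nth point [seq y z.1 | y <- ys] j)) *
   \int[(z.2 : probability (Vm d) R)]_nu
     (Por Kc (t z.1) (nth (fun=> point) ys i z.1) nu * p (nth (fun=> point) ys i z.1) nu)%:E)).
  apply: emeasurable_funM.
    apply: emeasurable_prod => j; under eq_fun do rewrite nth_map_fun.
    exact: measurable_margU_ev.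
  apply: (measurable_mix_ev _ _ (fun z => Por Kc (t z.1) (nth (fun=> point) ys i z.1) z.2
     * p (nth (fun=> point) ys i z.1) z.2)%R).
    apply: measurable_funM.
      have mg : measurable_fun setT (fun z : (O * Vm d)%type =>
          ((t z.1, nth (fun=> point) ys i z.1), z.2)).
        by apply: measurable_fun_pair => //; apply: measurable_fun_pair;
          exact: measurableT_comp.
      exact: (measurableT_comp mPor mg).
    have mg : measurable_fun setT (fun z : (O * Vm d)%type =>
        (nth (fun=> point) ys i z.1, z.2)).
      by apply: measurable_fun_pair => //; exact: measurableT_comp.
    exact: (measurableT_comp mp mg).
  by move=> z; exact: (Por_density_ge0 d p Kc p0).
move=> z; rewrite mule_ge0 ?prode_ge0//; apply: integral_ge0 => nu _.
by rewrite lee_fin (Por_density_ge0 d p Kc p0).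
Qed.

Lemma prod_insert_at (f : Um U -> \bar R) i u us : (i <= size us)%N ->
  \prod_(j < size (insert_at _ i u us) | j != i :> nat) f (nth point (insert_at _ i u us) j) =
  \prod_(v <- us) f v.
Proof.
move=> ius; rewrite -(big_mkord (fun j => j != i) (fun j => f (nth point (insert_at _ i u us) j))).
have sz : size (insert_at _ i u us) = (size us).+1.
  by rewrite size_cat /= addnS -size_cat cat_take_drop.
rewrite sz (@big_cat_nat _ _ _ i)//=; last exact: leqW.
rewrite [X in _ * X]big_ltn_cond// eqxx /=.
rewrite -[in RHS](cat_take_drop i us) big_cat /=; congr (_ * _).
- rewrite [RHS](big_nth point) size_takel// big_nat_cond [RHS]big_nat_cond.
  apply: eq_big => j; first by case: ltngtP => //; rewrite ?andbF.
  by case/andP => /andP[_ ji] _; rewrite /insert_at nth_cat size_takel// ji.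
- rewrite [RHS](big_nth point) size_drop -[X in \prod_(X <= _ < _ | _) _]add0n.
  rewrite big_addn subSS big_nat_cond [RHS]big_nat_cond; apply: eq_big => j.
    by rewrite gtn_eqF ?andbT// addnS ltnS leq_addl.
  case/andP => /andP[_ ji] _.
  rewrite /insert_at nth_cat size_takel// addnS ltnNge leqW ?leq_addl//=.
  by rewrite subSn ?leq_addl//= addnK nth_drop addnC.
Qed.

Lemma evid_insert_at i u us : evid Pi p (insert_at _ i u us) =
  \int[Pi]_G (\prod_(v <- us) margU p G v * margU p G u).
Proof.
apply: eq_integral => G _; rewrite big_cat big_cons /= muleCA muleC; congr (_ * _).
by rewrite -big_cat /= cat_take_drop.
Qed.

Lemma fine_scale (c : R) (x : \bar R) : (0 < c)%R -> fine (c%:E * x) = (c * fine x)%R.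
Proof.
move=> c0; case: x => [x| |] //=.
- by rewrite gt0_muley ?lte_fin// mulr0.
- by rewrite gt0_muleNy ?lte_fin// mulr0.
Qed.

(* When the evidence is [0] or [+oo], [postmean] is the zero set function
   ([x / 0 = 0] and [fine +oo = 0]), at distance at least [1] from [Gs]. *)
Lemma posterior_cases us :
  1 <= dBL (postmean Pi p us) Gs \/
  exists m : {measure set (Vm d) -> \bar R}, [/\ m setT = 1,
    forall A, measurable A -> postmean Pi p us A = m A &
    forall i t u, (i <= size us)%N ->
      pvalPB Pi p Kc i t (insert_at _ i u us) = pval_mix d p Kc m t u].
Proof.
set z := evid Pi p us.
have mw : measurable_fun setT (fun G : PV => \prod_(u <- us) margU p (G : probability (Vm d) R) u).
  apply: emeasurable_prod => u.
  have mG : measurable_fun setT (fun G : PV => (u, G)) by exact: measurable_fun_pair.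
  by apply: (measurableT_comp (measurable_margU_ev _ (Um U) id _) mG).
have w0 (G : PV) : 0 <= \prod_(u <- us) margU p (G : probability (Vm d) R) u.
  exact: prode_ge0.
have z0 : 0 <= z by apply: integral_ge0.
have [zbad|] := boolP ((z == 0) || (z == +oo)).
  left; have fz : fine z = 0%R by case/orP: zbad => /eqP ->.
  have post0 A : postmean Pi p us A = 0 by rewrite /postmean -/z fz invr0 mulr0.
  apply: ereal_sup_ubound; exists (fun=> 1%R).
    split => [x|x y]; first by rewrite normr1.
    by rewrite subrr normr0; case: md => d0 _ _ _.
  rewrite (setfun_eq_integral _ _ _ _ (mzero : set (Vm d) -> \bar R)); last first.
    by move=> A _; rewrite post0.
  rewrite integral_measure_zero (integral_cst Gs measurableT 1) mul1e.
  by rewrite [X in _ - X]probability_setT sub0e abseN abse1.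
rewrite negb_or => /andP[zn0 zny]; right.
have zfin : z \is a fin_num by rewrite ge0_fin_numE// ltey.
have fz0 : (0 < fine z)%R by rewrite fine_gt0// lt0e zn0 z0 ltey.
have [m [mE mI]] := mixture_measure _ _ _ (Vm d) R Pi _
  (fun G : PV => (G : probability (Vm d) R) : {measure set (Vm d) -> \bar R})
  w0 mw (fun A mA => measurable_ev _ _ _ A mA).
have mT : m setT = z.
  by rewrite mE; apply: eq_integral => G _; rewrite [X in _ * X]probability_setT mule1.
have iz0 : (0 <= (fine z)^-1)%R by rewrite invr_ge0 ltW.
(* [m] is the unnormalized posterior mean. The inverse evidence cancels between the numerator and
   the denominator of [pval_mix], which leaves the ratio in [pvalPB]. *)
pose m1 : {measure set (Vm d) -> \bar R} := mscale (NngNum iz0) m.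
have m1E A : m1 A = ((fine z)^-1)%:E * m A by [].
exists m1; split.
- by rewrite m1E mT -(fineK zfin) -EFinM mulVf// gt_eqF.
- move=> A mA; rewrite m1E /postmean -mE EFinM muleC; congr (_ * _).
  rewrite fineK// ge0_fin_numE//; apply: le_lt_trans (_ : z < +oo); last by rewrite ltey.
  by rewrite -mT; apply: le_measure; rewrite ?inE.
- move=> i t u ius.
  have m1I (f : Vm d -> R) : measurable_fun setT f -> (forall nu, 0 <= f nu)%R ->
      fine (\int[m1]_nu (f nu)%:E) = ((fine z)^-1 *
        fine (\int[Pi]_G (\prod_(u <- us) margU p (G : probability (Vm d) R) u *
          \int[(G : probability (Vm d) R)]_nu (f nu)%:E)))%R.
    move=> mf f0; rewrite ge0_integral_mscale//.
    - by rewrite fine_scale ?invr_gt0// mI//; exact/measurable_EFinP.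
    - exact/measurable_EFinP.
    - by move=> nu _; rewrite lee_fin.
  have mpu := measurable_fun_pair2 u mp.
  have mPoru : measurable_fun setT (fun nu => Por Kc t u nu * p u nu)%R.
    by apply: measurable_funM mpu; exact: (measurable_fun_pair2 (t, u) mPor).
  rewrite /pval_mix !m1I//; last by move=> nu; exact: (Por_density_ge0 d p Kc p0).
  rewrite invfM invrK mulrACA mulVf ?mul1r ?gt_eqF//.
  rewrite /pvalPB evid_insert_at; congr (fine _ / _)%R.
  apply: eq_integral => G _; rewrite prod_insert_at//; congr (_ * _).
  rewrite /insert_at nth_cat size_takel// ltnn subnn /=.
  by [].
Qed.

Definition rejection i a (us : seq (Um U)) : set (R * Um U) :=
  [set z | (pvalPB Pi p Kc i z.1 (insert_at _ i z.2 us) <= a)%R].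

Lemma measurable_rejection dO (O : measurableType dO) i a (ys : seq (O -> Um U)) :
  (forall y, List.In y ys -> measurable_fun setT y) ->
  measurable [set z : (O * (R * Um U))%type | rejection i a [seq y z.1 | y <- ys] z.2].
Proof.
move=> mys.
have mpv : measurable_fun setT (fun z : (O * (R * Um U))%type =>
    pvalPB Pi p Kc i z.2.1 (insert_at _ i z.2.2 [seq y z.1 | y <- ys])).
  have E (z : (O * (R * Um U))%type) : insert_at _ i z.2.2 [seq y z.1 | y <- ys] =
      [seq y z | y <- insert_at _ i (fun z => z.2.2) [seq (fun z => y z.1) | y <- ys]].
    by rewrite map_insert_at -map_comp.
  under eq_fun do rewrite E.
  apply: (measurable_pvalPB _ (O * (R * Um U))%type i (fun z => z.2.1)).
    exact: measurableT_comp.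
  move=> y /In_insert_at[->|/In_map[z zys ->]]; first exact: measurableT_comp.
  exact: (measurableT_comp (mys z zys) measurable_fst).
have mle : measurable_fun setT (fun z : (O * (R * Um U))%type =>
    (pvalPB Pi p Kc i z.2.1 (insert_at _ i z.2.2 [seq y z.1 | y <- ys]) <= a)%R).
  exact: measurable_fun_ler.
rewrite (_ : [set z | _] = setT `&` (fun z : (O * (R * Um U))%type =>
    (pvalPB Pi p Kc i z.2.1 (insert_at _ i z.2.2 [seq y z.1 | y <- ys]) <= a)%R)
    @^-1` [set true]); first exact: mle.
by rewrite setTI; apply/seteqP; split.
Qed.

Lemma measurable_rejection1 i a us : measurable (rejection i a us).
Proof.
have h : forall y, List.In y [seq (fun _ : unit => u) | u <- us] -> measurable_fun setT y.
  by move=> y /In_map[u _ ->]; exact: measurable_cst.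
have m := measurable_rejection _ unit i a _ h.
have mx : measurable_fun setT (fun z : (R * Um U)%type => (tt, z)).
  exact: measurable_fun_pair.
have := mx measurableT _ m; rewrite setTI; congr measurable.
by apply/seteqP; split => z /=; rewrite -map_comp map_id.
Qed.

Lemma mseqfun_rejection (mu : probability (R * Um U)%type R) i a k :
  mseqfun k (fun (_ : unit) us => mu (rejection i a us)).
Proof.
move=> dO' O' g ys mg mys sz.
have m := measurable_rejection _ O' i a _ mys.
apply: (measurable_section_probability _ O' _ (R * Um U)%type (fun=> mu)
  [set z | rejection i a [seq y z.1 | y <- ys] z.2]) => //.
Qed.

Lemma mseqfun_indicator i (a : R) k : mseqfun k (fun (_ : unit) (s : seq (R * Um U)%type) =>
  (if (pvalPB Pi p Kc i (nth (0%R, point) s i).1 (map snd s) <= a)%R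
   then 1%R else 0%R : R)%:E).
Proof.
move=> dO' O' g xs mg mxs sz; apply/measurable_EFinP.
apply: measurable_fun_ifT => //; apply: measurable_fun_ler => //.
under eq_fun do rewrite nth_map_fun -map_comp.
have E (o : O') : [seq (snd \o (fun x : O' -> (R * Um U)%type => x o)) y | y <- xs] =
    [seq y o | y <- [seq (fun o => (x o).2) | x <- xs]] by rewrite -map_comp.
under eq_fun do rewrite E.
apply: (measurable_pvalPB).
  apply: measurableT_comp => //; exact: measurable_nth.
by move=> y /In_map[x /mxs mx ->]; exact: measurableT_comp.
Qed.

End posterior.

(** * The limit superior, and the average over the other units *)

Lemma limn_esup_eq0 (R : realType) (u : (\bar R)^nat) :
  (forall n, 0 <= u n)%E ->
  (forall e : R, 0 < e -> \forall n \near \oo, (u n <= e%:E)%E) ->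
  limn_esup u = 0%E.
Proof.
move=> u0 ue; apply/eqP; rewrite eq_le; apply/andP; split.
  apply/lee_addgt0Pr => e e0; rewrite add0e.
  have [N _ hN] := ue e e0.
  apply: (@le_trans _ _ (ereal_sup (u @` [set n | (N <= n)%N]))).
    apply: ereal_inf_lbound; exists [set n | (N <= n)%N] => //.
    exact: nbhs_infty_ge.
  by apply: ge_ereal_sup => _ [n Nn <-]; exact: hN.
apply: le_ereal_inf_tmp => _ [A [N _ AN] <-].
apply: (le_trans (u0 N)); apply: ereal_sup_ubound; exists N => //.
by apply: AN => /=.
Qed.

Lemma dBL_ge0 (R : realType) (V : pointedType) (d : V -> V -> R)
    (m1 m2 : set (Vm d) -> \bar R) : is_metric d -> (0 <= dBL m1 m2)%E.
Proof.
case=> d0 _ _ _.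
apply: (@le_trans _ _ `|\int[m1]_x (0 : R)%:E - \int[m2]_x (0 : R)%:E|%E) => //.
apply: ereal_sup_ubound; exists (fun=> 0) => //.
by split => *; rewrite ?subrr normr0.
Qed.

Theorem theorem3
  (R : realType)
  (* nuisance parameter space V with metric d *)
  (V : pointedType) (d : V -> V -> R)
  (* space of the nuisance statistics U_i, with reference measure lambda *)
  (U : ptopologicalType) (lam : {measure set (Um U) -> \bar R})
  (* primary parameter space and null value *)
  (Th : Type) (th0 : Th)
  (* conditional law of (T_i, U_i) given (theta_i, nu_i) *)
  (kappa : Th -> Vm d -> probability (R * Um U)%type R)
  (* densities p(u | nu) of U_i given nu_i w.r.t. lambda *)
  (p : Um U -> Vm d -> R)
  (* conditional law of T_i given nu_i = nu, U_i = u, under theta_i = theta_0 *)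
  (Kc : Vm d -> Um U -> probability R R)
  (* prior Pi on probability measures on V *)
  (Pi : probability (pprobability (Vm d) R) R)
  (* true G* and true primary parameters theta*_n = (thn n 0, ..., thn n (n-1)) *)
  (Gs : probability (Vm d) R) (thn : nat -> nat -> Th) :
  is_metric d ->
  (* well-definedness of the model: measurability of kernels and densities *)
  (forall th (A : set (R * Um U)%type), measurable A ->
     measurable_fun setT (fun nu : Vm d => kappa th nu A)) ->
  (forall nu (A : set R), measurable A ->
     measurable_fun setT (fun u : Um U => Kc nu u A)) ->
  measurable_fun setT (fun x : (Um U * Vm d)%type => p x.1 x.2) ->
  (forall u nu, 0 <= p u nu) ->
  (* the law of U_i depends only on nu_i and has density p(.|nu) w.r.t. lambda *)
  (forall th nu (B : set (Um U)), measurable B ->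
     kappa th nu (setT `*` B) = lawU lam p nu B) ->
  (* Kc is the conditional law of T_i given (nu_i, U_i) under theta_0 *)
  (forall nu (A : set R) (B : set (Um U)), measurable A -> measurable B ->
     kappa th0 nu (A `*` B) = (\int[lam]_(u in B) (Kc nu u A * (p u nu)%:E))%E) ->
  (* Assumption 1 *)
  (forall nu u, Kc nu u `<< (@lebesgue_measure R)) ->
  (* Assumption 2 *)
  dcompact_space d ->
  (* Assumption 3 *)
  (forall e : R, 0 < e -> exists2 delta : R, 0 < delta &
     forall (t : R) (u : Um U) (nu nu' : Vm d), d nu nu' < delta ->
       `|Por Kc t u nu - Por Kc t u nu'| < e) ->
  (* Assumption 4 *)
  (forall e : R, 0 < e -> exists C : set U, compact C /\
     forall nu : Vm d, (lawU lam p nu (~` C) < e%:E)%E) ->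
  (forall C : set U, compact C ->
     [/\ (lam C < +oo)%E,
         exists M : R, forall (u : Um U) (nu : Vm d), C u -> p u nu <= M &
         forall (nu : Vm d) (e : R), 0 < e -> exists2 delta : R, 0 < delta &
           forall (u : Um U) (nu' : Vm d), C u -> d nu nu' < delta ->
             `|p u nu - p u nu'| < e]) ->
  (* consistency of the posterior mean in expected bounded Lipschitz distance *)
  (expected_dBL Gs kappa thn Pi p @ \oo --> 0%E) ->
  limn_esup (calib_err th0 Gs kappa thn Pi p Kc) = 0%E.
Proof.
move=> md mkappa mKc mp p0 kappaU kappa0E acKc cd equiKc tight Cprop consistent.
have p1 nu : (\int[lam]_u (p u nu)%:E = 1)%E.
  have := kappaU th0 nu setT measurableT.
  by rewrite setXTT probability_setT /lawU => <-.
have equip (C : set U) (cC : compact C) := let: And3 _ _ h := Cprop C cC in h.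
have boundp (C : set U) (cC : compact C) := let: And3 _ h _ := Cprop C cC in h.
have mPor := measurable_Por d Kc md cd mKc equiKc.
have /choice[mu hmu] th := unit_law d Gs kappa mkappa th.
have muE th A : (mu th A = \int[Gs]_nu kappa th nu A)%E := (hmu th).1 A.
have muI th f : (forall x, 0 <= f x)%E -> measurable_fun setT f ->
  (\int[mu th]_x f x = \int[Gs]_nu \int[kappa th nu]_x f x)%E := (hmu th).2 f.
(* All units share one law of [U], because the right-hand side of [kappaU] does not involve [th]. *)
have [mU mUE] : exists mU : probability (Um U) R,
    forall th B, measurable B -> mu th (snd @^-1` B) = mU B.
  have msnd : measurable_fun setT (snd : (R * Um U)%type -> Um U) by [].
  have [mU mUE] := probabilityP _ _ _
    (@measure_function_pushforward__canonical__measure_function_Measure _ _ _ _ R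
      (mu th0) (snd : (R * Um U)%type -> Um U) msnd) (probability_setT (mu th0)).
  exists mU => th B mB; rewrite mUE /= /pushforward !muE; apply: eq_integral => nu _.
  have -> : snd @^-1` B = setT `*` B :> set (R * Um U)%type.
    by apply/seteqP; split => x //= [].
  by rewrite !kappaU.
apply: limn_esup_eq0 => [n|e e0]; first by apply: ereal_sup_ubound; left.
have e20 : 0 < e / 2 by rewrite divr_gt0.
have [dl /andP[dl0 dl1] hdl] := calibration_close d lam p Kc (kappa th0) Gs md cd
  mp p0 p1 tight equip boundp mKc acKc equiKc (kappa0E) _ e20.
have [N _ hN] : \forall n \near \oo,
    (expected_dBL Gs kappa thn Pi p n < (dl * (e / 2))%:E)%E.
  by apply: cvge0_lt consistent _; rewrite mulr_gt0.
have dl_ge0 := ltW dl0.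
(* Sample size [n.+1] leaves [n >= N] other units, the size at which consistency is used. [N] is
   fixed before [i] and [a]. *)
exists N.+1 => // -[//|n] /= Nn.
apply: ge_ereal_sup => _ [->|[i [a [ilt thi a01 ->]]]]; first by rewrite lee_fin ltW.
have i_le : (i <= n)%N by rewrite -ltnS.
have /andP[a0 a1] := a01.
pose P us := mu th0 (rejection d p Kc Pi i a us).
have mrej us : measurable (rejection d p Kc Pi i a us).
  exact: measurable_rejection1.
have P_le1 us : (P us <= 1)%E by exact: probability_le1.
have P_fin us : P us \is a fin_num by rewrite fin_num_measure.
(* [q] is the miscalibration given [us] in excess of [e / 2]. It is at most [1], and [0] when the
   distance is at most [dl], so [dl * q] is a measurable minorant of the distance. Hence Markov's
   inequality in the form [Iq < e / 2]. *)
pose q us := Num.max 0 (`|fine (P us) - a| - e / 2).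
have q0 us : 0 <= q us by rewrite le_max lexx.
have fP0 us : 0 <= fine (P us) by rewrite fine_ge0.
have fP1 us : fine (P us) <= 1 by rewrite -lee_fin fineK.
have q1 us : q us <= 1.
  have h : `|fine (P us) - a| <= 1.
    by rewrite ler_norml; have := fP0 us; have := fP1 us; lra.
  by rewrite ge_max ler01 /= lerBlDr (le_trans h)// lerDl ltW.
have q_le_dBL us : size us = n -> ((dl * q us)%:E <= dBL (postmean Pi p us) Gs)%E.
  move=> usn.
  have [close|far] := leP (dBL (postmean Pi p us) Gs) dl%:E; last first.
    by rewrite (le_trans _ (ltW far))// lee_fin ler_piMr// ltW.
  have [one_le|[m [m1 postm pvalm]]] := posterior_cases d p Kc Pi Gs md mp p0 mPor us.
    by have := le_trans one_le close; rewrite lee_fin leNgt dl1.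
  have rejE : rejection d p Kc Pi i a us = [set z | pval_mix d p Kc m z.1 z.2 <= a].
    by apply/seteqP; split => z; rewrite /rejection /= pvalm// usn.
  have BLclose psi : BL1 d psi ->
      (`|\int[m]_nu (psi nu)%:E - \int[Gs]_nu (psi nu)%:E| <= dl%:E)%E.
    move=> psi1; apply: le_trans close.
    rewrite -(setfun_eq_integral _ _ _ _ _ _ postm).
    by apply: ereal_sup_ubound; exists psi.
  have := hdl m m1 BLclose a a01; rewrite /= -rejE -muE -/(P us) -(fineK (P_fin us)).
  move=> /(_ (mrej us)); rewrite -!EFinD !lee_fin => -[h1 h2].
  have -> : q us = 0.
    apply/eqP; rewrite eq_le q0 andbT ge_max lexx /= subr_le0 ler_norml.
    by lra.
  by rewrite mulr0; exact: dBL_ge0.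
have mP k : mseqfun k (fun (_ : unit) us => P us) by exact: mseqfun_rejection.
have mq k : mseqfun k (fun (_ : unit) us => (q us)%:E).
  move=> dO' O' g ys mg mys sz; apply/measurable_EFinP.
  apply: measurable_maxr => //; apply: measurable_funB => //.
  apply: measurableT_comp => //; apply: measurable_funB => //.
  by apply: measurableT_comp => //; exact: (mP k _ O' g ys mg mys sz).
have mdq k : mseqfun k (fun (_ : unit) us => (0%:E + dl%:E * (q us)%:E)%E).
  move=> dO' O' g ys mg mys sz; apply: emeasurable_funD => //.
  apply: measurable_funeM; exact: (mq k _ O' g ys mg mys sz).
have q0E us : (0 <= (q us)%:E)%E by rewrite lee_fin.
pose Iq := iterint (nseq n mU) (fun us => (q us)%:E).
have Iq_ge0 : (0 <= Iq)%E by exact: iterint_ge0.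
have Iq_lt : (Iq < (e / 2)%:E)%E.
  have : (dl%:E * Iq < dl%:E * (e / 2)%:E)%E.
    rewrite -EFinM; apply: le_lt_trans (hN n _) => //.
    have szL : size (nseq n mU) = n by rewrite size_nseq.
    rewrite -[leLHS]add0e -(iterint_affine _ unit (nseq n mU) (fun _ us => (q us)%:E) tt)//.
    rewrite /expected_dBL.
    pose L := [seq mu (thn n j) | j <- iota 0 n].
    have sL : size L = n by rewrite size_map size_iota.
    (* The average under [mU] is read as one over a sample with parameters [thn n], although the
       other units have parameters from [thn n.+1]: the law of [U] is the same for both. *)
    have -> : iterint (nseq n mU) (fun us => (0%:E + dl%:E * (q us)%:E)%E) =
        dataint Gs kappa (thn n) 0 n
          (fun s => (0%:E + dl%:E * (q (map snd s))%:E)%E).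
      rewrite -{1}sL -(iterint_map _ (R * Um U)%type _ (Um U) snd mU L _ unit
        (fun _ us => (0%:E + dl%:E * (q us)%:E)%E) tt)//.
      - rewrite (dataint_iterint d Gs kappa mu (thn n) _ unit 0 n
          (fun _ s => (0%:E + dl%:E * (q (map snd s))%:E)%E) tt)//.
        + by move=> _ s; rewrite add0e mule_ge0// lee_fin ltW.
        + move=> dO' O' g xs mg mxs sz.
          have E (o : O') : map snd [seq x o | x <- xs] =
              [seq y o | y <- [seq (fun o => (x o).2) | x <- xs]] by rewrite -!map_comp.
          under eq_fun do rewrite E.
          apply: (mdq n _ O' g) => //; last by rewrite size_map.
          by move=> y /In_map[x /mxs mx ->]; exact: measurableT_comp.
      - by move=> Q /In_map[j _ ->] B mB; exact: mUE.
      - by move=> _ s; rewrite add0e mule_ge0// lee_fin ltW.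
    apply: le_dataint => s.
      by rewrite add0e mule_ge0// lee_fin ltW.
    move=> sn; rewrite add0e -EFinM; apply: q_le_dBL.
    by rewrite size_map.
  by rewrite lte_pmul2l.
have probE : prob_pval_le Gs kappa thn Pi p Kc n.+1 i a = iterint (nseq n mU) P.
  rewrite /prob_pval_le.
  pose F (_ : unit) (s : seq (R * Um U)%type) := (if
     pvalPB Pi p Kc i (nth (0, point) s i).1 (map snd s) <= a then 1 else 0 : R)%:E.
  have F0 o s : (0 <= F o s)%E by rewrite /F lee_fin; case: ifP.
  have mF k : mseqfun k F by exact: mseqfun_indicator.
  rewrite [LHS](dataint_iterint d Gs kappa mu (thn n.+1) _ unit 0 n.+1 F tt)//.
  pose L := [seq mu (thn n.+1 j) | j <- iota 0 n.+1].
  have sL : size L = n.+1 by rewrite size_map size_iota.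
  (* [L'] lists the laws of the other units; [thi] identifies the removed law as [mu th0]. *)
  pose L' := [seq mu (thn n.+1 j) | j <- take i (iota 0 n.+1) ++ drop i.+1 (iota 0 n.+1)].
  have L'E : L' = take i L ++ drop i.+1 L by rewrite /L' map_cat map_take map_drop.
  have stk : size (take i L) = i by rewrite size_takel// sL ltnW.
  have sL' : size L' = n.
    by rewrite L'E size_cat stk size_drop sL subSS subnKC.
  have LE : L = take i L' ++ mu th0 :: drop i L'.
    rewrite L'E take_size_cat// drop_size_cat// -{1}(cat_take_drop i L).
    rewrite (drop_nth (mu th0)) ?sL//; congr (_ ++ _ :: _).
    by rewrite (nth_map 0%N) ?size_iota// nth_iota// add0n thi.
  rewrite -/L LE (iterint_insert _ unit L' (mu th0) i F tt)//.
  rewrite -{1}sL' -(iterint_map _ (R * Um U)%type _ (Um U) snd mU L' _ unit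
     (fun _ us => P us) tt)//; last first.
    by move=> Q /In_map[j _ ->] B mB; exact: mUE.
  apply: eq_iterint => s; rewrite sL' => sn.
  have -> : P (map snd s) =
      (\int[mu th0]_x (\1_(rejection d p Kc Pi i a (map snd s)) x)%:E)%E.
    by rewrite integral_indic// setIT.
  apply: eq_integral => z _; rewrite /F nth_cat size_takel ?sn// ltnn subnn /=.
  rewrite -/(insert_at _ i z s) map_insert_at indicE; congr (_%:E).
  case: ifPn => h; first by rewrite mem_set.
  by rewrite memNset//; apply/negP.
rewrite probE.
set PP := iterint (nseq n mU) P.
have PP0 : (0 <= PP)%E by exact: iterint_ge0.
have szL : size (nseq n mU) = n by rewrite size_nseq.
have Iq1 (c : R) : 0 <= c ->
    iterint (nseq n mU) (fun us => (c%:E + 1%:E * (q us)%:E)%E) = (c%:E + Iq)%E.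
  move=> c0; rewrite (iterint_affine _ unit (nseq n mU) (fun _ us => (q us)%:E) tt)// ?szL//.
  by rewrite mul1e.
have qP us : fine (P us) <= a + e / 2 + q us /\ a <= fine (P us) + (e / 2 + q us).
  have : `|fine (P us) - a| - e / 2 <= q us by rewrite le_max lexx orbT.
  by rewrite lerBlDr ler_norml => /andP[]; lra.
have up : (PP <= (a + e / 2)%:E + Iq)%E.
  rewrite -Iq1; last by rewrite addr_ge0// ltW.
  apply: (iterint_le _ unit (nseq n mU) (fun _ us => P us)
    (fun _ us => ((a + e / 2)%:E + 1%:E * (q us)%:E)%E) tt) => // _ us.
  by rewrite mul1e -(fineK (P_fin us)) -EFinD lee_fin (qP us).1.
have lo : (a%:E <= PP + ((e / 2)%:E + Iq))%E.
  rewrite -Iq1; last exact: ltW.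
  rewrite -(iterint_add _ unit (nseq n mU) (fun _ us => P us)
    (fun _ us => ((e / 2)%:E + 1%:E * (q us)%:E)%E) tt)//; last 2 first.
  - move=> _ us; apply: adde_ge0; first by rewrite lee_fin ltW.
    by rewrite mul1e lee_fin.
  - rewrite szL => dO' O' g ys mg mys sz; apply: emeasurable_funD => //.
    apply: measurable_funeM; exact: (mq n _ O' g ys mg mys sz).
  (* The constant is written as an iterated integral over probabilities so that [iterint_le]
     applies. *)
  have -> : a%:E = iterint (nseq n mU) (fun us => (a%:E + 0%:E * P us)%E).
    rewrite (iterint_affine _ unit (nseq n mU) (fun _ us => P us) tt)//.
    by rewrite mul0e adde0.
  apply: (iterint_le _ unit (nseq n mU) (fun _ us => (a%:E + 0%:E * P us)%E)
    (fun _ us => (P us + ((e / 2)%:E + 1%:E * (q us)%:E))%E) tt) => _ us.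
    by rewrite mul0e adde0 lee_fin.
  by rewrite mul0e adde0 mul1e -(fineK (P_fin us)) -!EFinD lee_fin (qP us).2.
have Iqfin : Iq \is a fin_num by rewrite ge0_fin_numE// (lt_trans Iq_lt)// ltry.
have PPfin : PP \is a fin_num.
  by rewrite ge0_fin_numE// (le_lt_trans up)// -(fineK Iqfin) -EFinD ltry.
move: up lo Iq_lt; rewrite -(fineK Iqfin) -(fineK PPfin) -!EFinD !lee_fin lte_fin.
move=> up lo Iq_lt; rewrite ler_norml; lra.
Qed.
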